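(* Let $\mathcal{C}$ be a type I self-dual Weyl tensor and let $\Psi_0,\dots,\Psi_4$ be its components in an arbitrary null frame $\{l,k,m,\bar m\}$ with associated null bivector base $\{\mathbf{W},\mathbf{U},\mathbf{V}\}$. Then the principal transverse frames $\{l_{(i)},k_{(i)},m_{(i)},\bar m_{(i)}\}$, $i=1,2,3$, can be obtained as $$l_{(i)}=\frac1{\sqrt2}(e_0+e_i),\qquad k_{(i)}=\frac1{\sqrt2}(e_0-e_i),\qquad m_{(i)}=\frac1{\sqrt2}(e_j+\mathrm{i}\,e_k),$$ where $(i,j,k)$ runs over the cyclic permutations of $(1,2,3)$ and $\{e_0,e_1,e_2,e_3\}$ is the orthonormal Weyl canonical frame given (by formulas stated for a non transverse frame $\{l,k,m,\bar m\}$) by $$e_0=\frac{1}{2\sqrt b}\,(a\,l+b\,k+c\,m+\bar c\,\bar m),\qquad e_i=\sqrt2\,\mathbf{W}_i(e_0),\quad i=1,2,3.$$ Here $$\mathbf{W}_i=\frac{1}{\sqrt{D_iC_i}}\big(A_i\mathbf{U}+B_i\mathbf{W}+C_i\mathbf{V}\big),\qquad i=1,2,3,$$ with the signs of the square roots chosen so that $\{\mathbf{W}_1,\mathbf{W}_2,\mathbf{W}_3\}$ is oriented, $$b=\sum_{i=1}^3\frac{|C_i|}{|D_i|},\qquad c=-\sum_{i=1}^3\frac{\bar B_iC_i}{|D_i||C_i|},\qquad a=2+\frac{c\bar c}{b},$$ $$A_i=\Psi_0\Psi_4+\Psi_2^2-2\Psi_1\Psi_3+\alpha_i\Psi_2+(\alpha_i^2-I),\qquad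 B_i=\Psi_1\Psi_4-\Psi_2\Psi_3+\Psi_3\alpha_i,$$ $$C_i=2\Psi_2\Psi_4-2\Psi_3^2+\alpha_i\Psi_4,\qquad D_i=\tfrac12(I-3\alpha_i^2),$$ $$\alpha_1=\beta+\frac{I}{3\beta},\qquad \alpha_2=-\tfrac12\Big((1-\mathrm{i}\sqrt3)\beta+(1+\mathrm{i}\sqrt3)\frac{I}{3\beta}\Big),\qquad \alpha_3=-\tfrac12\Big((1+\mathrm{i}\sqrt3)\beta+(1-\mathrm{i}\sqrt3)\frac{I}{3\beta}\Big),$$ $$I = \Psi_0\Psi_4-4\Psi_1\Psi_3+3\Psi_2^2,\qquad J=\begin{vmatrix}\Psi_4&\Psi_3&\Psi_2\\ \Psi_3&\Psi_2&\Psi_1\\ \Psi_2&\Psi_1&\Psi_0\end{vmatrix},\qquad \beta=\sqrt[3]{J+\sqrt{J^2-I^3/27}},$$ where $\beta$ is a particular non-zero value of this root.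
   Context: Everything is pointwise on an oriented, time-oriented 4-dimensional spacetime with metric $g$ of signature $(-+++)$ and volume element $\eta$. Vectors and 1-forms are identified by $g$, and for a 2-form $X$ and a vector $y$, $X(y)_\alpha=X_{\alpha\beta}y^\beta$. Self-dual 2-forms. $X$ is self-dual if $*X=\mathrm{i}X$, $*$ the Hodge dual. On the 3-dimensional complex space of self-dual 2-forms use the metric $(X,Y)=\frac12X_{\alpha\beta}Y^{\alpha\beta}$, i.e. the metric $\mathcal{G}=\frac12(G-\mathrm{i}\eta)$, $G$ being the usual metric on 2-forms. A unitary self-dual 2-form satisfies $(X,X)=-1$. The product of 2-forms is $(A\times B)_{\alpha\beta}=A_\alpha{}^{\lambda}B_{\lambda\beta}$, and $a\wedge b=a\otimes b-b\otimes a$. Weyl tensor. The self-dual Weyl tensor is $\mathcal{C}=\frac12(C-\mathrm{i}*C)$, $C$ the Weyl tensor, regarded as a trace-free, $(\cdot,\cdot)$-symmetric endomorphism of the space of self-dual 2-forms; $(A\otimes B)(X)=A\,(B,X)$. Its characteristic equation is $x^3-Ix-2J=0$ with $I=\frac12\operatorname{tr}\mathcal{C}^2$, $J=\frac16\operatorname{tr}\mathcal{C}^3$. Type I means that the three roots $\alpha_1,\alpha_2,\alpha_3$ are distinct, equivalently $27J^2\neq I^3$. Then there are unitary, mutually orthogonal eigenvectors $\mathbf{W}_i$, $\mathcal{C}(\mathbf{W}_i)=\alpha_i\mathbf{W}_i$, called principal 2-forms, unique up to sign, with $\mathcal{C}=-\sum_i\alpha_i\mathbf{W}_i\otimes\mathbf{W}_i$.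 The eigenframe $\{\mathbf{W}_i\}$ is oriented if $\mathbf{W}_3=\mathrm{i}\sqrt2\,\mathbf{W}_1\times\mathbf{W}_2$. Null frames and components. A null frame (null tetrad) $\{l,k,m,\bar m\}$ has $l,k$ real future-pointing null vectors, $m$ complex null, $l\cdot k=-1$, $m\cdot\bar m=1$, other products zero. Its associated null bivector base is $\mathbf{W}=\frac1{\sqrt2}(l\wedge k+m\wedge\bar m)$, $\mathbf{U}=-\frac1{\sqrt2}l\wedge\bar m$, $\mathbf{V}=\frac1{\sqrt2}k\wedge m$, the tetrad being oriented so that these are self-dual (so $(\mathbf{W},\mathbf{W})=-1$, $(\mathbf{U},\mathbf{V})=\frac12$, other products zero). The components $\Psi_a$ are defined by $$\tfrac12\mathcal{C}=\Psi_0\mathbf{U}\otimes\mathbf{U}+\Psi_1\mathbf{U}\tilde\otimes\mathbf{W}+\Psi_2(\mathbf{U}\tilde\otimes\mathbf{V}+\mathbf{W}\otimes\mathbf{W})+\Psi_3\mathbf{W}\tilde\otimes\mathbf{V}+\Psi_4\mathbf{V}\otimes\mathbf{V},$$ with $A\tilde\otimes B=A\otimes B+B\otimes A$. The frame is transverse if $\Psi_1=\Psi_3=0$, and non transverse otherwise. Weyl canonical frame. The three principal 2-forms determine six principal 2-planes (a time-like one and its orthogonal space-like one for each $\mathbf{W}_i$), which cut in four mutually orthogonal directions, one time-like and three space-like. The Weyl canonical frame corresponding to an oriented eigenframe $\{\mathbf{W}_i\}$ is the orthonormal frame $\{e_0,e_1,e_2,e_3\}$ along these directions, $e_0$ time-like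 and future-pointing, such that $\mathbf{W}_i=\frac1{\sqrt2}\big(e_0\wedge e_i-\mathrm{i}*(e_0\wedge e_i)\big)$ for $i=1,2,3$. Principal transverse frames. A principal transverse frame is a null tetrad $\{l,k,m,\bar m\}$ (oriented so that the 2-forms $\frac1{\sqrt2}(l\wedge k+m\wedge\bar m)$, $-\frac1{\sqrt2}l\wedge\bar m$, $\frac1{\sqrt2}k\wedge m$ of its associated bivector base are self-dual) whose components satisfy $\Psi_1=\Psi_3=0$ and $\Psi_0=\Psi_4$; the first element of its associated bivector base is then $\pm\mathbf{W}_i$ for some $i$, and the frame $\{l_{(i)},k_{(i)},m_{(i)},\bar m_{(i)}\}$ is one corresponding to $\mathbf{W}_i$. For given $i$ such a frame is determined up to the choice of signs and order of the elements of the oriented eigenframe. (The roman $\mathrm{i}$ is the imaginary unit; the italic subscript $i$ is an index.)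
   Formalization: If some C_i = 0 (possible for at most one i, e.g. in transverse frames), the formula for W_i and its term in c read 0/0; there the formula for that W_i is not imposed, W_i is fixed by the orientation of the eigenframe, and its term in c is taken as 0. *)

(* Defs.v *)
(* Pointwise Lorentzian geometry in an arbitrary basis of the tangent space.  Vectors are columns of (complex) contravariant components
   x^a; 2-forms are matrices of covariant components X_ab. *)
From HB Require Import structures.
From mathcomp Require Import all_boot all_order all_algebra all_fingroup.
From mathcomp Require Import reals.
From mathcomp Require Export complex.

Set Implicit Arguments.
Unset Strict Implicit.
Unset Printing Implicit Defensive.
Import Order.TTheory GRing.Theory Num.Theory.
Local Open Scope ring_scope.

(* The tangent space at a point of an oriented, time-oriented spacetime.
   [vol] is the component eta_{0123} of the volume element (its sign is the
   orientation) and [tdir] is a time-like vector declared future-pointing. *)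
Record spacetime_point (R : realType) := SpacetimePoint {
  gram : 'M[R]_4;
  vol : R;
  tdir : 'cV[R]_4;
  gram_lorentz : exists2 P : 'M[R]_4, P \in unitmx &
    P^T *m gram *m P = diag_mx (\row_(i < 4) (if i == 0 then -1 else 1));
  vol_unit : vol ^+ 2 = - \det gram;
  tdir_timelike : (tdir^T *m gram *m tdir) 0 0 < 0
}.

Definition metric (R : realType) (S : spacetime_point R) : 'M[R[i]]_4 :=
  map_mx (real_complex R) (gram S).

(* Complex-bilinear extension of the metric (no conjugation). *)
Definition dot (R : realType) (S : spacetime_point R) (x y : 'cV[R[i]]_4)
    : R[i] :=
  (x^T *m metric S *m y) 0 0.

Definition conj_mx (R : realType) (m n : nat) (A : 'M[R[i]]_(m, n))
    : 'M[R[i]]_(m, n) :=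
  \matrix_(i, j) (A i j)^*.

Definition is_real_vec (R : realType) (x : 'cV[R[i]]_4) : Prop := conj_mx x = x.

Definition future_pointing (R : realType) (S : spacetime_point R)
    (x : 'cV[R[i]]_4) : Prop :=
  [/\ is_real_vec x, x != 0, dot S x x <= 0 &
      dot S x (map_mx (real_complex R) (tdir S)) < 0].

(* X^{ab} = g^{ac} X_cd g^{db} *)
Definition raise (R : realType) (S : spacetime_point R) (X : 'M[R[i]]_4)
    : 'M[R[i]]_4 :=
  invmx (metric S) *m X *m invmx (metric S).

Definition wedge (R : realType) (S : spacetime_point R) (a b : 'cV[R[i]]_4)
    : 'M[R[i]]_4 :=
  (metric S *m a) *m (metric S *m b)^T - (metric S *m b) *m (metric S *m a)^T.

(* X(y)_a = X_ab y^b, with the index raised. *)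
Definition form_app (R : realType) (S : spacetime_point R) (X : 'M[R[i]]_4)
    (y : 'cV[R[i]]_4) : 'cV[R[i]]_4 :=
  invmx (metric S) *m (X *m y).

(* (A x B)_ab = A_a^c B_cb *)
Definition form_mul (R : realType) (S : spacetime_point R) (A B : 'M[R[i]]_4)
    : 'M[R[i]]_4 :=
  A *m invmx (metric S) *m B.

(* (X, Y) = X_ab Y^ab / 2 *)
Definition form_ip (R : realType) (S : spacetime_point R) (X Y : 'M[R[i]]_4)
    : R[i] :=
  2^-1 * \sum_(a < 4) \sum_(b < 4) X a b * raise S Y a b.

(* The determinant is the Levi-Civita symbol [abcd]. *)
Definition eta (R : realType) (S : spacetime_point R) (a b c d : 'I_4) : R[i] :=
  real_complex R (vol S) *
  \det (\matrix_(i < 4, j < 4) (tnth [tuple a; b; c; d] i == j)%:R : 'M[R[i]]_4).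

(* The dual of X has components eta_abcd X^cd / 2. *)
Definition hodge (R : realType) (S : spacetime_point R) (X : 'M[R[i]]_4)
    : 'M[R[i]]_4 :=
  \matrix_(a < 4, b < 4)
    (2^-1 * \sum_(c < 4) \sum_(d < 4) eta S a b c d * raise S X c d).

Definition self_dual (R : realType) (S : spacetime_point R) (X : 'M[R[i]]_4)
    : Prop :=
  X^T = - X /\ hodge S X = 'i *: X.

Definition is_weyl_tensor (R : realType) (S : spacetime_point R)
    (Cw : 'I_4 -> 'I_4 -> 'I_4 -> 'I_4 -> R) : Prop :=
  [/\ forall a b c d, Cw a b c d = - Cw b a c d,
      forall a b c d, Cw a b c d = Cw c d a b,
      forall a b c d, Cw a b c d + Cw a c d b + Cw a d b c = 0 &
      forall b d,
        \sum_(a < 4) \sum_(c < 4) invmx (gram S) a c * Cw a b c d = 0].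

(* X |-> C_abcd X^cd / 2 *)
Definition weyl_op (R : realType) (S : spacetime_point R)
    (Cw : 'I_4 -> 'I_4 -> 'I_4 -> 'I_4 -> R) (X : 'M[R[i]]_4) : 'M[R[i]]_4 :=
  \matrix_(a < 4, b < 4)
    (2^-1 * \sum_(c < 4) \sum_(d < 4)
       real_complex R (Cw a b c d) * raise S X c d).

(* (C - i *C) / 2, the dual being taken on the first pair of indices. *)
Definition sd_weyl (R : realType) (S : spacetime_point R)
    (Cw : 'I_4 -> 'I_4 -> 'I_4 -> 'I_4 -> R) (X : 'M[R[i]]_4) : 'M[R[i]]_4 :=
  2^-1 *: (weyl_op S Cw X - 'i *: hodge S (weyl_op S Cw X)).

(* [sd_weyl] is defined on all 4 x 4 matrices.  It takes self-dual values and
   vanishes on symmetric and on anti-self-dual matrices, so the traces below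
   are those of its restriction to the 3-dimensional space of self-dual
   2-forms. *)
Definition invI (R : realType) (S : spacetime_point R)
    (Cw : 'I_4 -> 'I_4 -> 'I_4 -> 'I_4 -> R) : R[i] :=
  2^-1 * \tr (lin_mx (sd_weyl S Cw \o sd_weyl S Cw)).

Definition invJ (R : realType) (S : spacetime_point R)
    (Cw : 'I_4 -> 'I_4 -> 'I_4 -> 'I_4 -> R) : R[i] :=
  6^-1 * \tr (lin_mx (sd_weyl S Cw \o sd_weyl S Cw \o sd_weyl S Cw)).

Definition char_eq (R : realType) (S : spacetime_point R)
    (Cw : 'I_4 -> 'I_4 -> 'I_4 -> 'I_4 -> R) (x : R[i]) : Prop :=
  x ^+ 3 - invI S Cw * x - 2 * invJ S Cw = 0.

Definition type_I (R : realType) (S : spacetime_point R)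
    (Cw : 'I_4 -> 'I_4 -> 'I_4 -> 'I_4 -> R) : Prop :=
  exists x : 'I_3 -> R[i], injective x /\ forall i, char_eq S Cw (x i).

(* In triples indexed by 'I_3 the entries 0, 1, 2 stand for the indices
   1, 2, 3; [ordS] is the cyclic successor. *)
Definition principal_forms (R : realType) (S : spacetime_point R)
    (Cw : 'I_4 -> 'I_4 -> 'I_4 -> 'I_4 -> R)
    (al : 'I_3 -> R[i]) (W : 'I_3 -> 'M[R[i]]_4) : Prop :=
  [/\ forall i, self_dual S (W i),
      forall i j, form_ip S (W i) (W j) = - (i == j)%:R &
      forall i, sd_weyl S Cw (W i) = al i *: W i].

Definition oriented_triple (R : realType) (S : spacetime_point R)
    (W : 'I_3 -> 'M[R[i]]_4) : Prop :=
  W 2 = ('i * sqrtC 2) *: form_mul S (W 0) (W 1).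

Record tetrad (R : realType) := Tetrad {
  lvec : 'cV[R[i]]_4;
  kvec : 'cV[R[i]]_4;
  mvec : 'cV[R[i]]_4
}.

Definition null_tetrad (R : realType) (S : spacetime_point R) (T : tetrad R)
    : Prop :=
  let l := lvec T in let k := kvec T in let m := mvec T in
  [/\ future_pointing S l /\ future_pointing S k,
      [/\ dot S l l = 0, dot S k k = 0 & dot S l k = -1],
      dot S m m = 0 /\ dot S m (conj_mx m) = 1 &
      dot S l m = 0 /\ dot S k m = 0].

Definition bivW (R : realType) (S : spacetime_point R) (T : tetrad R) :=
  (sqrtC 2)^-1 *: (wedge S (lvec T) (kvec T)
                   + wedge S (mvec T) (conj_mx (mvec T))) : 'M[R[i]]_4.
Definition bivU (R : realType) (S : spacetime_point R) (T : tetrad R) :=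
  - (sqrtC 2)^-1 *: wedge S (lvec T) (conj_mx (mvec T)) : 'M[R[i]]_4.
Definition bivV (R : realType) (S : spacetime_point R) (T : tetrad R) :=
  (sqrtC 2)^-1 *: wedge S (kvec T) (mvec T) : 'M[R[i]]_4.

Definition null_frame (R : realType) (S : spacetime_point R) (T : tetrad R)
    : Prop :=
  null_tetrad S T /\
  [/\ self_dual S (bivW S T), self_dual S (bivU S T) & self_dual S (bivV S T)].

Definition tens (R : realType) (S : spacetime_point R) (A B X : 'M[R[i]]_4)
    : 'M[R[i]]_4 :=
  form_ip S B X *: A.
Definition stens (R : realType) (S : spacetime_point R) (A B X : 'M[R[i]]_4)
    : 'M[R[i]]_4 :=
  tens S A B X + tens S B A X.

Definition weyl_components (R : realType) (S : spacetime_point R)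
    (Cw : 'I_4 -> 'I_4 -> 'I_4 -> 'I_4 -> R) (T : tetrad R)
    (Psi : 'I_5 -> R[i]) : Prop :=
  let W := bivW S T in let U := bivU S T in let V := bivV S T in
  forall X : 'M[R[i]]_4,
    2^-1 *: sd_weyl S Cw X =
      Psi 0 *: tens S U U X + Psi 1 *: stens S U W X
      + Psi 2 *: (stens S U V X + tens S W W X)
      + Psi 3 *: stens S W V X + Psi 4 *: tens S V V X.

Definition principal_transverse_frame (R : realType) (S : spacetime_point R)
    (Cw : 'I_4 -> 'I_4 -> 'I_4 -> 'I_4 -> R) (T : tetrad R) : Prop :=
  null_frame S T /\
  exists2 Psi : 'I_5 -> R[i], weyl_components S Cw T Psi &
    [/\ Psi 1 = 0, Psi 3 = 0 & Psi 0 = Psi 4].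

Definition frame_corresponds (R : realType) (S : spacetime_point R)
    (T : tetrad R) (W : 'M[R[i]]_4) : Prop :=
  bivW S T = W \/ bivW S T = - W.

(* A unitary self-dual X is (F - i *F) / sqrt 2 for a real simple 2-form F
   whose 2-plane is time-like, so that Re X = F / sqrt 2 and
   Im X = - *F / sqrt 2.  The time-like plane of X is the annihilator of *F,
   and its space-like plane is the annihilator of F. *)
Definition timelike_plane (R : realType) (X : 'M[R[i]]_4) (x : 'cV[R[i]]_4)
    : Prop :=
  is_real_vec x /\ (X - conj_mx X) *m x = 0.
Definition spacelike_plane (R : realType) (X : 'M[R[i]]_4) (x : 'cV[R[i]]_4)
    : Prop :=
  is_real_vec x /\ (X + conj_mx X) *m x = 0.

Definition weyl_canonical_frame (R : realType) (S : spacetime_point R)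
    (W : 'I_3 -> 'M[R[i]]_4)
    (e0 : 'cV[R[i]]_4) (e : 'I_3 -> 'cV[R[i]]_4) : Prop :=
  [/\ future_pointing S e0 /\ forall i, is_real_vec (e i),
      [/\ dot S e0 e0 = -1, forall i, dot S e0 (e i) = 0 &
          forall i j, dot S (e i) (e j) = (i == j)%:R],
      forall i, timelike_plane (W i) e0,
      forall i j, if i == j then timelike_plane (W i) (e j)
                  else spacelike_plane (W i) (e j) &
      forall i, W i = (sqrtC 2)^-1 *:
        (wedge S e0 (e i) - 'i *: hodge S (wedge S e0 (e i)))].

Definition tetrad_of (R : realType)
    (e0 : 'cV[R[i]]_4) (e : 'I_3 -> 'cV[R[i]]_4) (i : 'I_3) : tetrad R :=
  Tetrad ((sqrtC 2)^-1 *: (e0 + e i))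
         ((sqrtC 2)^-1 *: (e0 - e i))
         ((sqrtC 2)^-1 *: (e (ordS i) + 'i *: e (ordS (ordS i)))).

Definition psiI (R : realType) (Psi : 'I_5 -> R[i]) : R[i] :=
  Psi 0 * Psi 4 - 4 * Psi 1 * Psi 3 + 3 * Psi 2 ^+ 2.

Definition psiJ (R : realType) (Psi : 'I_5 -> R[i]) : R[i] :=
  \det (\matrix_(i < 3, j < 3) Psi (inord (4 - (i + j)))).

(* [beta] is a non-zero value of the cube root, for some choice of the
   inner square root. *)
Definition is_beta (R : realType) (Psi : 'I_5 -> R[i]) (beta : R[i]) : Prop :=
  beta != 0 /\
  exists2 s : R[i], s ^+ 2 = psiJ Psi ^+ 2 - psiI Psi ^+ 3 / 27 &
    beta ^+ 3 = psiJ Psi + s.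

Definition alpha (R : realType) (Psi : 'I_5 -> R[i]) (beta : R[i]) (i : 'I_3)
    : R[i] :=
  let I := psiI Psi in
  tnth [tuple
    beta + I / (3 * beta);
    - 2^-1 * ((1 - 'i * sqrtC 3) * beta + (1 + 'i * sqrtC 3) * (I / (3 * beta)));
    - 2^-1 * ((1 + 'i * sqrtC 3) * beta + (1 - 'i * sqrtC 3) * (I / (3 * beta)))
  ] i.

Definition coefA (R : realType) (Psi : 'I_5 -> R[i]) (x : R[i]) : R[i] :=
  Psi 0 * Psi 4 + Psi 2 ^+ 2 - 2 * Psi 1 * Psi 3 + x * Psi 2
  + (x ^+ 2 - psiI Psi).
Definition coefB (R : realType) (Psi : 'I_5 -> R[i]) (x : R[i]) : R[i] :=
  Psi 1 * Psi 4 - Psi 2 * Psi 3 + Psi 3 * x.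
Definition coefC (R : realType) (Psi : 'I_5 -> R[i]) (x : R[i]) : R[i] :=
  2 * Psi 2 * Psi 4 - 2 * Psi 3 ^+ 2 + x * Psi 4.
Definition coefD (R : realType) (Psi : 'I_5 -> R[i]) (x : R[i]) : R[i] :=
  2^-1 * (psiI Psi - 3 * x ^+ 2).

(* W_i = (A_i U + B_i W + C_i V) / r_i with r_i some square root of D_i C_i.
   When C_i = 0 also A_i = B_i = 0 and this reads 0 / 0; at most one C_i
   vanishes, and the remaining W_i is then determined by the orientation
   condition [oriented_triple]. *)
Definition principal_formula (R : realType) (S : spacetime_point R)
    (T : tetrad R) (Psi : 'I_5 -> R[i]) (al : 'I_3 -> R[i])
    (W : 'I_3 -> 'M[R[i]]_4) : Prop :=
  forall i, coefC Psi (al i) != 0 ->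
    exists2 r : R[i], r ^+ 2 = coefD Psi (al i) * coefC Psi (al i) &
      W i = r^-1 *: (coefA Psi (al i) *: bivU S T
                     + coefB Psi (al i) *: bivW S T
                     + coefC Psi (al i) *: bivV S T).

Definition coefb (R : realType) (Psi : 'I_5 -> R[i]) (al : 'I_3 -> R[i])
    : R[i] :=
  \sum_(i < 3) `|coefC Psi (al i)| / `|coefD Psi (al i)|.
(* The i-th summand has modulus |B_i| / |D_i|, hence is 0 when C_i = 0, in
   accordance with x / 0 = 0. *)
Definition coefc (R : realType) (Psi : 'I_5 -> R[i]) (al : 'I_3 -> R[i])
    : R[i] :=
  - \sum_(i < 3) (coefB Psi (al i))^* * coefC Psi (al i)
                 / (`|coefD Psi (al i)| * `|coefC Psi (al i)|).
Definition coefa (R : realType) (Psi : 'I_5 -> R[i]) (al : 'I_3 -> R[i])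
    : R[i] :=
  2 + coefc Psi al * (coefc Psi al)^* / coefb Psi al.

Definition canonical_e0 (R : realType) (T : tetrad R) (Psi : 'I_5 -> R[i])
    (al : 'I_3 -> R[i]) : 'cV[R[i]]_4 :=
  let a := coefa Psi al in let b := coefb Psi al in let c := coefc Psi al in
  (2 * sqrtC b)^-1 *: (a *: lvec T + b *: kvec T
                       + c *: mvec T + c^* *: conj_mx (mvec T)).

Definition canonical_ei (R : realType) (S : spacetime_point R)
    (W : 'I_3 -> 'M[R[i]]_4) (e0 : 'cV[R[i]]_4) (i : 'I_3) : 'cV[R[i]]_4 :=
  sqrtC 2 *: form_app S (W i) e0.

(* Main.v *)
(* In the basis U, W, V of a null tetrad a self-dual 2-form has coordinates
   (p, q, r), and an oriented orthonormal triple of self-dual 2-forms obeys the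
   relations of the Pauli matrices.  Hence e_i = sqrt 2 W_i(e_0) completes a unit
   time-like e_0 to an orthonormal frame as soon as the e_i are real, and then
   W_i = (e_0 /\ e_i + i e_j /\ e_k) / sqrt 2.  With r_i the V-coordinate of W_i
   and q_i its W-coordinate, the coefficients of the statement are
   b = sum |r_i|^2 and c = - sum conj(q_i) r_i, and reality of the e_i comes from
   the orientation relations and sum r_i^2 = 0.
   The formula for W_i reads off the V-row of
   2 D_i W_i (x) W_i = C^2 + alpha_i C + (alpha_i^2 - I); where C_i = 0 the form
   W_i is recovered as the oriented product of the two others.
   Conversely, in a principal transverse frame - W, V - U and - i (U + V) are
   principal 2-forms, and the condition that all W_i(e_0) be real forces
   e_0 = (l + k) / sqrt 2 up to sign. *)
Require Import Defs.
From mathcomp Require Import all_boot all_order all_algebra all_fingroup.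
From mathcomp Require Import reals complex ring lra.
Set Implicit Arguments.
Unset Strict Implicit.
Unset Printing Implicit Defensive.
Import Order.TTheory GRing.Theory Num.Theory.
Local Open Scope ring_scope.

(** * Lorentzian algebra over an abstract field *)

(** Origin of a, b, c: in the canonical frame W_i x conj(W_i) acts as 1/2 on the time-like plane of
    W_i and as -1/2 on its space-like plane, so the sum over i acts as 3/2 on e_0 and as -1/2 on
    every e_j. Hence l + 2 sum W_i(conj(W_i)(l)) is a multiple of e_0. Its k- and m-coordinates are
    sum |r_i|^2 and - sum conj(q_i) r_i, and a = 2 + |c|^2 / b is what the norm -1 then requires.
    This sum is insensitive to the signs and the order of the W_i, hence so is e_0, which is what
    lets the converse work with a reordered eigenframe. The derivation presupposes a canonical
    frame, so the proof treats the resulting e_0 as a candidate: the burden is to show that it makes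
    all the e_i real. *)

Section ConjMatrix.
Variable C : numClosedFieldType.

Definition cjmx m n (A : 'M[C]_(m, n)) : 'M[C]_(m, n) :=
  \matrix_(i, j) (A i j)^*.

Lemma cjmxE m n (A : 'M[C]_(m, n)) : cjmx A = map_mx Num.conj A.
Proof. by apply/matrixP => i j; rewrite !mxE. Qed.

Lemma cjmxK m n (A : 'M[C]_(m, n)) : cjmx (cjmx A) = A.
Proof. by apply/matrixP => i j; rewrite !mxE conjCK. Qed.

Lemma cjmxD m n (A B : 'M[C]_(m, n)) :
  cjmx (A + B) = cjmx A + cjmx B.
Proof. by rewrite !cjmxE map_mxD. Qed.

Lemma cjmxN m n (A : 'M[C]_(m, n)) : cjmx (- A) = - cjmx A.
Proof. by rewrite !cjmxE map_mxN. Qed.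

Lemma cjmxZ m n a (A : 'M[C]_(m, n)) : cjmx (a *: A) = a^* *: cjmx A.
Proof. by rewrite !cjmxE map_mxZ. Qed.

Lemma cjmxM m n p (A : 'M[C]_(m, n)) (B : 'M_(n, p)) :
  cjmx (A *m B) = cjmx A *m cjmx B.
Proof. by rewrite !cjmxE map_mxM. Qed.

Lemma cjmx_tr m n (A : 'M[C]_(m, n)) : cjmx A^T = (cjmx A)^T.
Proof. by apply/matrixP => i j; rewrite !mxE. Qed.

End ConjMatrix.

(* The data of [spacetime_point], over an abstract field: over the concrete
   [R[i]] unification would unfold the construction of the complex numbers. *)
Record lorentz_data (C : numClosedFieldType) := LorentzData {
  gmx : 'M[C]_4;
  star : 'M[C]_4 -> 'M[C]_4;
  gmx_sym : gmx^T = gmx;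
  gmx_unit : gmx \in unitmx;
  gmx_real : cjmx gmx = gmx;
  starD : forall X Y, star (X + Y) = star X + star Y;
  starZ : forall a X, star (a *: X) = a *: star X;
  star_conj : forall X, star (cjmx X) = cjmx (star X)
}.

Section LorentzAlgebra.
Variables (C : numClosedFieldType) (G : lorentz_data C).
Local Notation g := (gmx G).

Definition pdot (x y : 'cV[C]_4) : C := (x^T *m g *m y) 0 0.
Definition praise (X : 'M[C]_4) : 'M[C]_4 := invmx g *m X *m invmx g.
Definition pwedge (a b : 'cV[C]_4) : 'M[C]_4 :=
  (g *m a) *m (g *m b)^T - (g *m b) *m (g *m a)^T.
Definition papp (X : 'M[C]_4) (y : 'cV[C]_4) : 'cV[C]_4 := invmx g *m (X *m y).
Definition pmul (A B : 'M[C]_4) : 'M[C]_4 := A *m invmx g *m B.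
Definition pip (X Y : 'M[C]_4) : C :=
  2^-1 * \sum_(a < 4) \sum_(b < 4) X a b * praise Y a b.
Definition pself_dual (X : 'M[C]_4) : Prop := X^T = - X /\ star G X = 'i *: X.

Lemma invg_sym : (invmx g)^T = invmx g.
Proof. by rewrite trmx_inv (gmx_sym G). Qed.

Lemma cjmx_invg : cjmx (invmx g) = invmx g.
Proof. by rewrite cjmxE map_invmx -cjmxE (gmx_real G). Qed.

Lemma pdotC x y : pdot x y = pdot y x.
Proof.
rewrite /pdot; have -> : x^T *m g *m y = (y^T *m g *m x)^T.
  by rewrite !trmx_mul trmxK (gmx_sym G) mulmxA.
by rewrite mxE.
Qed.

Lemma pdotDl x y z : pdot (x + y) z = pdot x z + pdot y z.
Proof. by rewrite /pdot linearD /= !mulmxDl mxE. Qed.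

Lemma pdotDr x y z : pdot z (x + y) = pdot z x + pdot z y.
Proof. by rewrite pdotC pdotDl !(pdotC z). Qed.

Lemma pdotZl a x z : pdot (a *: x) z = a * pdot x z.
Proof. by rewrite /pdot linearZ /= -!scalemxAl mxE. Qed.

Lemma pdotZr a x z : pdot z (a *: x) = a * pdot z x.
Proof. by rewrite pdotC pdotZl pdotC. Qed.

Lemma pdot0r x : pdot x 0 = 0.
Proof. by rewrite /pdot mulmx0 mxE. Qed.

Lemma pdotNl x z : pdot (- x) z = - pdot x z.
Proof. by rewrite -scaleN1r pdotZl mulN1r. Qed.

Lemma pdotNr x z : pdot z (- x) = - pdot z x.
Proof. by rewrite pdotC pdotNl pdotC. Qed.

Lemma pdot_conj x y : pdot (cjmx x) (cjmx y) = (pdot x y)^*.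
Proof. by rewrite /pdot -[X in _ *m X *m _](gmx_real G) -cjmx_tr -!cjmxM mxE. Qed.

Lemma pappDl X Y v : papp (X + Y) v = papp X v + papp Y v.
Proof. by rewrite /papp mulmxDl mulmxDr. Qed.

Lemma pappZl a X v : papp (a *: X) v = a *: papp X v.
Proof. by rewrite /papp -scalemxAl -scalemxAr. Qed.

Lemma pappNl X v : papp (- X) v = - papp X v.
Proof. by rewrite -scaleN1r pappZl scaleN1r. Qed.

Lemma pappDr X v w : papp X (v + w) = papp X v + papp X w.
Proof. by rewrite /papp !mulmxDr. Qed.

Lemma pappZr a X v : papp X (a *: v) = a *: papp X v.
Proof. by rewrite /papp -!scalemxAr. Qed.

Lemma papp_mul X Y v : papp (pmul X Y) v = papp X (papp Y v).
Proof. by rewrite /papp /pmul !mulmxA. Qed.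

Lemma papp_metric v : papp g v = v.
Proof. by rewrite /papp mulKmx ?(gmx_unit G). Qed.

Lemma papp_conj X v : papp (cjmx X) v = cjmx (papp X (cjmx v)).
Proof. by rewrite /papp !cjmxM cjmx_invg cjmxK. Qed.

Lemma papp_eq0 X v : papp X v = 0 -> X *m v = 0.
Proof. by rewrite /papp => /(congr1 (mulmx g)); rewrite mulKVmx ?(gmx_unit G) ?mulmx0. Qed.

Lemma papp_inj X Y : (forall v, papp X v = papp Y v) -> X = Y.
Proof.
move=> eXY; apply/row_matrixP => i; apply/rowP => j.
have /(congr1 (mulmx g)) := eXY (delta_mx j 0).
rewrite /papp !(mulKVmx (gmx_unit G)) -!colE => /colP/(_ i).
by rewrite !mxE.
Qed.

Lemma papp_wedge a b v :
  papp (pwedge a b) v = pdot b v *: a - pdot a v *: b.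
Proof.
have outer x y : invmx g *m (((g *m x) *m (g *m y)^T) *m v) = pdot y v *: x.
  rewrite trmx_mul (gmx_sym G) !mulmxA mulVmx ?(gmx_unit G) // mul1mx.
  rewrite -!mulmxA (mulmxA y^T).
  by rewrite [y^T *m g *m v]mx11_scalar mul_mx_scalar.
by rewrite /papp /pwedge mulmxBl mulmxBr !outer.
Qed.

Lemma pdot_app X x y : X^T = - X -> pdot x (papp X y) = - pdot (papp X x) y.
Proof.
move=> asX; rewrite /pdot /papp !trmx_mul invg_sym asX.
rewrite !mulmxA -(mulmxA x^T g) mulmxV ?(gmx_unit G) // mulmx1.
rewrite -(mulmxA _ (invmx g)) mulVmx ?(gmx_unit G) // mulmx1.
by rewrite !mulmxN !mulNmx [in RHS]mxE opprK.
Qed.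

Lemma pwedge_asym a b : (pwedge a b)^T = - pwedge a b.
Proof. by rewrite /pwedge linearB /= !trmx_mul !trmxK opprB -!trmx_mul. Qed.

Lemma pmulZl a A X : pmul (a *: A) X = a *: pmul A X.
Proof. by rewrite /pmul -!scalemxAl. Qed.
Lemma pmulZr a A X : pmul X (a *: A) = a *: pmul X A.
Proof. by rewrite /pmul -!scalemxAr. Qed.
Lemma pmulA A B X :
  pmul A (pmul B X) = pmul (pmul A B) X.
Proof. by rewrite /pmul !mulmxA. Qed.
Lemma pmul_metric A : pmul A g = A.
Proof. by rewrite /pmul -mulmxA mulVmx ?(gmx_unit G) // mulmx1. Qed.

Lemma praiseD X Y : praise (X + Y) = praise X + praise Y.
Proof. by rewrite /praise mulmxDr mulmxDl. Qed.
Lemma praiseZ a X : praise (a *: X) = a *: praise X.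
Proof. by rewrite /praise -scalemxAr -scalemxAl. Qed.

Lemma pip_trace X Y : pip X Y = 2^-1 * \tr (X^T *m praise Y).
Proof.
rewrite /pip; congr (2^-1 * _); rewrite exchange_big /mxtrace /=.
by apply: eq_bigr => a _; rewrite mxE; apply: eq_bigr => b _; rewrite [X^T _ _]mxE.
Qed.

Lemma pipDr X Y Z : pip X (Y + Z) = pip X Y + pip X Z.
Proof. by rewrite !pip_trace praiseD mulmxDr mxtraceD mulrDr. Qed.
Lemma pipZr a X Y : pip X (a *: Y) = a * pip X Y.
Proof. by rewrite !pip_trace praiseZ -scalemxAr mxtraceZ mulrCA. Qed.

Lemma pipC X Y : pip X Y = pip Y X.
Proof.
rewrite !pip_trace /praise -mxtrace_tr !trmx_mul trmxK invg_sym.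
by rewrite [in RHS]mulmxA [in RHS]mxtrace_mulC !mulmxA.
Qed.

Lemma pipDl X Y Z : pip (Y + Z) X = pip Y X + pip Z X.
Proof. by rewrite pipC pipDr !(pipC X). Qed.
Lemma pipZl a X Y : pip (a *: X) Y = a * pip X Y.
Proof. by rewrite pipC pipZr pipC. Qed.

Lemma pip_mul X Y : X^T = - X ->
  pip X Y = - 2^-1 * \tr (pmul X Y *m invmx g).
Proof.
move=> asX; rewrite pip_trace asX /praise /pmul mulNmx linearN.
by rewrite mulrN mulNr !mulmxA.
Qed.

Lemma tr_asym X : X^T = - X -> \tr (X *m invmx g) = 0.
Proof.
move=> asX; have : \tr (X *m invmx g) = - \tr (X *m invmx g).
  by rewrite -{1}mxtrace_tr trmx_mul invg_sym asX mulmxN linearN mxtrace_mulC.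
by move/eqP; rewrite -addr_eq0 -mulr2n mulrn_eq0 /= => /eqP.
Qed.

Lemma pself_dualD X Y : pself_dual X -> pself_dual Y -> pself_dual (X + Y).
Proof.
case=> aX hX [aY hY]; split; first by rewrite linearD /= aX aY opprD.
by rewrite starD hX hY scalerDr.
Qed.
Lemma pself_dualZ k X : pself_dual X -> pself_dual (k *: X).
Proof.
case=> aX hX; split; first by rewrite linearZ /= aX scalerN.
by rewrite starZ hX !scalerA mulrC.
Qed.

Lemma pwedgeDl a a' b : pwedge (a + a') b = pwedge a b + pwedge a' b.
Proof.
apply: papp_inj => v.
rewrite pappDl !papp_wedge pdotDl scalerDr scalerDl; move: (_ *: a) (_ *: a') (_ *: b) (_ *: b).
by move=> x y z t; apply/matrixP => i j; rewrite !mxE; ring.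
Qed.

Lemma pwedgeC a b : pwedge a b = - pwedge b a.
Proof. by rewrite /pwedge opprB. Qed.

Lemma pwedge_self a : pwedge a a = 0.
Proof. by rewrite /pwedge subrr. Qed.

Lemma pwedgeZl k a b : pwedge (k *: a) b = k *: pwedge a b.
Proof.
apply: papp_inj => v.
by rewrite pappZl !papp_wedge pdotZl scalerBr !scalerA mulrC.
Qed.

Lemma pwedgeDr a b b' : pwedge a (b + b') = pwedge a b + pwedge a b'.
Proof. by rewrite pwedgeC pwedgeDl opprD -!(pwedgeC a). Qed.

Lemma pwedgeZr k a b : pwedge a (k *: b) = k *: pwedge a b.
Proof. by rewrite pwedgeC pwedgeZl -scalerN -pwedgeC. Qed.

Lemma pwedge_pairs k a a' b b' : pwedge (k *: (a + a')) (k *: (b + b')) =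
  (k * k) *: (pwedge a b + pwedge a b' + (pwedge a' b + pwedge a' b')).
Proof. by rewrite pwedgeZl pwedgeZr pwedgeDl !pwedgeDr scalerA. Qed.

End LorentzAlgebra.

(** Serves both the null tetrad and the canonical frame, where scalar products supply the
    freeness. *)
Lemma span4 (C : fieldType) (t : 'I_4 -> 'cV[C]_4) :
  (forall x : 'I_4 -> C, \sum_j x j *: t j = 0 -> forall j, x j = 0) ->
  forall v, exists x : 'I_4 -> C, v = \sum_j x j *: t j.
Proof.
move=> free_t.
pose P : 'M[C]_4 := \matrix_(i, j) t j i 0.
have Px x : P *m x = \sum_j x j 0 *: t j.
  apply/colP => i; rewrite mxE summxE; apply: eq_bigr => j _.
  by rewrite !mxE mulrC.
have Pu : P \in unitmx.
  rewrite -unitmx_tr -row_free_unit; apply: inj_row_free => x xP.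
  have xT j : x 0 j = x^T j 0 by rewrite mxE.
  apply/rowP => j; rewrite [RHS]mxE xT; move: j; apply: free_t.
  by rewrite -Px -[P]trmxK -trmx_mul xP trmx0.
by move=> v; exists (fun j => (invmx P *m v) j 0); rewrite -Px mulKVmx.
Qed.

(** * Oriented orthonormal triples of coordinates *)

Lemma ordS3 (i : 'I_3) : ordS (ordS (ordS i)) = i.
Proof. by apply/val_inj; case: i => [[|[|[|i]]] //]. Qed.

Lemma ordS_neq (i : 'I_3) : [/\ i != ordS i, ordS i != ordS (ordS i) & ordS (ordS i) != i].
Proof. by case: i => [[|[|[|i]]] //]. Qed.

Lemma ord3_cases (i j : 'I_3) : [\/ j = i, j = ordS i | j = ordS (ordS i)].
Proof.
case: i j => [[|[|[|i]]] Hi] [[|[|[|j]]] Hj] //;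
  solve [constructor 1; exact/val_inj | constructor 2; exact/val_inj
        | constructor 3; exact/val_inj].
Qed.

Lemma sum_ord3 (V : nmodType) (F : 'I_3 -> V) (i : 'I_3) :
  \sum_j F j = F i + F (ordS i) + F (ordS (ordS i)).
Proof.
have [n1 n2 n3] := ordS_neq i.
rewrite (bigD1 i) //= (bigD1 (ordS i)) 1?eq_sym //= (bigD1 (ordS (ordS i))) /=.
  rewrite big1 ?addr0 ?addrA // => j.
  by case: (ord3_cases i j) => ->; rewrite ?eqxx ?andbF.
by rewrite n3 eq_sym n2.
Qed.

Arguments sum_ord3 {V F} i.

(** Serves the two degenerate situations in which one index may be bad: a vanishing C_i and a
    vanishing eigenvalue. The form at the bad index is then the product of the two others. *)
Lemma ord3_choice (P : pred 'I_3) :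
  (forall i j, ~~ P i -> ~~ P j -> i = j) ->
  exists i, P (ordS i) && P (ordS (ordS i)).
Proof.
move=> uP; have [n1 n2 n3] := ordS_neq 0.
case: (boolP (P 0)) => h0; last first.
  exists 0; apply/andP; split; apply/negPn/negP => h.
    by case/eqP: n1; apply: uP.
  by case/eqP: n3; apply: uP.
case: (boolP (P (ordS 0))) => h1; last first.
  exists (ordS 0); rewrite ordS3 h0 andbT; apply/negPn/negP => h.
  by case/eqP: n2; apply: uP.
by exists (ordS (ordS 0)); rewrite ordS3 h0.
Qed.

Section Triples.
Variable C : numClosedFieldType.
Implicit Types p q r : 'I_3 -> C.

(** Certificates: an equality that follows from hypotheses is derived with explicit cofactors [k],
    which leaves a polynomial identity for [ring] or [field]. *)
Lemma linear_comb1 (l m k x y : C) : x = y -> l - m = k * (x - y) -> l = m.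
Proof. by move=> -> /eqP; rewrite subrr mulr0 subr_eq0 => /eqP. Qed.

Lemma linear_comb2 (l m k1 k2 x1 y1 x2 y2 : C) :
  x1 = y1 -> x2 = y2 -> l - m = k1 * (x1 - y1) + k2 * (x2 - y2) -> l = m.
Proof.
by move=> -> -> /eqP; rewrite !subrr !mulr0 addr0 subr_eq0 => /eqP.
Qed.

Lemma linear_comb3 (l m k1 k2 k3 x1 y1 x2 y2 x3 y3 : C) :
  x1 = y1 -> x2 = y2 -> x3 = y3 ->
  l - m = k1 * (x1 - y1) + k2 * (x2 - y2) + k3 * (x3 - y3) -> l = m.
Proof.
by move=> -> -> -> /eqP; rewrite !subrr !mulr0 !addr0 subr_eq0 => /eqP.
Qed.

Let ii : 'i * 'i = -1 :> C. Proof. by rewrite -expr2 sqrCi. Qed.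

(* Coordinates in U, W, V, whose only nonzero products are (U, V) = 1/2 and
   (W, W) = -1. *)
Definition orthonormal_triple p q r : Prop :=
  forall i j, 2^-1 * (p i * r j + r i * p j) - q i * q j = - (i == j)%:R.

Definition oriented_coords p q r : Prop := forall i,
  [/\ p (ordS (ordS i)) = 'i * (p i * q (ordS i) - q i * p (ordS i)),
      q (ordS (ordS i)) = 'i * (2^-1 * (p i * r (ordS i) - r i * p (ordS i))) &
      r (ordS (ordS i)) = 'i * (q i * r (ordS i) - r i * q (ordS i))].

(** With the W_i as rows of a square matrix, orthonormality exhibits a right inverse; it is also a
    left inverse, which is the completeness relation: - sum W_i (x) W_i is the inverse metric on
    self-dual 2-forms. *)
Lemma orthonormal_complete p q r : orthonormal_triple p q r ->
  [/\ \sum_i p i * p i = 0, \sum_i p i * q i = 0 & \sum_i p i * r i = - 2] /\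
  [/\ \sum_i q i * q i = 1, \sum_i q i * r i = 0 & \sum_i r i * r i = 0].
Proof.
move=> h.
pose E : 'M[C]_3 := \matrix_(i, a) tnth [tuple p i; q i; r i] a.
(* The transpose of [E] multiplied by minus the Gram matrix of U, W, V. *)
pose F : 'M[C]_3 := \matrix_(a, i) tnth [tuple - 2^-1 * r i; q i; - 2^-1 * p i] a.
have EF : E *m F = 1%:M.
  apply/matrixP => i j; rewrite !mxE (sum_ord3 0) !mxE /=.
  rewrite /tnth /= -[RHS]opprK -h; ring.
have /matrixP FE := mulmx1C EF.
have FEab a b : \sum_i F a i * E i b = (a == b)%:R by move: (FE a b); rewrite !mxE.
have half (x y : C) : - 2^-1 * x = y -> x = - 2 * y by move=> <-; field.
split; split.
- move: (FEab (ordS (ordS 0)) 0).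
  under eq_bigr do rewrite !mxE /tnth /= -mulrA.
  by rewrite -mulr_sumr => /half ->; rewrite mulr0.
- move: (FEab (ordS (ordS 0)) (ordS 0)).
  under eq_bigr do rewrite !mxE /tnth /= -mulrA.
  by rewrite -mulr_sumr => /half ->; rewrite mulr0.
- move: (FEab (ordS (ordS 0)) (ordS (ordS 0))).
  under eq_bigr do rewrite !mxE /tnth /= -mulrA.
  by rewrite -mulr_sumr => /half ->; rewrite mulr1.
- move: (FEab (ordS 0) (ordS 0)).
  by under eq_bigr do rewrite !mxE /tnth /=.
- move: (FEab (ordS 0) (ordS (ordS 0))).
  by under eq_bigr do rewrite !mxE /tnth /=.
- move: (FEab 0 (ordS (ordS 0))).
  under eq_bigr do rewrite !mxE /tnth /= -mulrA.
  by rewrite -mulr_sumr => /half ->; rewrite mulr0.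
Qed.

Definition rr r : C := \sum_i r i * (r i)^*.
Definition qr q r : C := - \sum_i (q i)^* * r i.

Lemma conj_qr q r : (qr q r)^* = - \sum_i q i * (r i)^*.
Proof.
rewrite /qr rmorphN rmorph_sum; congr (- _); apply: eq_bigr => i _.
by rewrite rmorphM /= conjCK.
Qed.

(** The left side is sum_j (q_i r_j - r_i q_j) conj(r_j), whose brackets are given by the
    orientation relations. The right side has the form i (z - conj z), so it is real; it is the
    k-coordinate of e_i up to a real factor. *)
Lemma qb_rc p q r i : oriented_coords p q r ->
  q i * rr r + r i * (qr q r)^* =
  'i * (r (ordS i) * (r (ordS (ordS i)))^* - r (ordS (ordS i)) * (r (ordS i))^*).
Proof.
move=> o; have [_ _ h1] := o i; have [_ _] := o (ordS (ordS i)).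
rewrite !ordS3 => h2; rewrite conj_qr /rr !(sum_ord3 i).
apply: (linear_comb2 (k1 := 'i * (r (ordS i))^*)
  (k2 := - 'i * (r (ordS (ordS i)))^*) h1 h2).
by ring: ii.
Qed.

(** In sum_j (p_i r_j - q_i q_j) conj(r_j) the part of the bracket symmetric in i, j is the scalar
    product - delta_ij, and the antisymmetric part (p_i r_j - r_i p_j) / 2 is an orientation
    relation. *)
Lemma pb_qc p q r i : orthonormal_triple p q r -> oriented_coords p q r ->
  p i * rr r + q i * (qr q r)^* = - (r i)^* +
  'i * (q (ordS i) * (r (ordS (ordS i)))^* - q (ordS (ordS i)) * (r (ordS i))^*).
Proof.
move=> h o; have [_ h1 _] := o i; have [_] := o (ordS (ordS i)).
rewrite !ordS3 => h2 _; rewrite conj_qr /rr !(sum_ord3 i).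
have [n1 n2 n3] := ordS_neq i; rewrite eq_sym in n3.
have := h i (ordS (ordS i)); have := h i (ordS i); have := h i i.
rewrite eqxx (negPf n1) (negPf n3) /= => o1 o2 o3.
have e1 : p i * r i - q i * q i = -1 by rewrite -[RHS]o1; field.
have e2 : p i * r (ordS i) - q i * q (ordS i) = - 'i * q (ordS (ordS i)).
  by apply: (linear_comb2 (k1 := 1) (k2 := 'i) o2 h1); field: ii.
have e3 : p i * r (ordS (ordS i)) - q i * q (ordS (ordS i)) = 'i * q (ordS i).
  by apply: (linear_comb2 (k1 := 1) (k2 := - 'i) o3 h2); field: ii.
by apply: (linear_comb3 (k1 := (r i)^*) (k2 := (r (ordS i))^*)
  (k3 := (r (ordS (ordS i)))^*) e1 e2 e3); ring.
Qed.

Lemma rr_conj r : (rr r)^* = rr r.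
Proof.
rewrite /rr rmorph_sum; apply: eq_bigr => i _.
by rewrite rmorphM /= conjCK mulrC.
Qed.

Lemma qb_rc_conj p q r i : oriented_coords p q r ->
  (q i * rr r + r i * (qr q r)^*)^* = q i * rr r + r i * (qr q r)^*.
Proof.
move=> o; rewrite (qb_rc _ o) !(rmorphM, rmorphB) /= conjCi !conjCK; ring.
Qed.

(* This vanishing, divided by b, says that the m- and mbar-components of e_i are
   conjugate to each other; it holds because conj(sum r_i^2) = 0. *)
Lemma pb2_2qbc_rc2 p q r i :
  orthonormal_triple p q r -> oriented_coords p q r ->
  p i * rr r ^+ 2 + 2 * q i * rr r * (qr q r)^* + r i * (qr q r)^* ^+ 2
  + 2 * rr r * (r i)^* = 0.
Proof.
move=> h o; have h1 := pb_qc i h o; have h2 := qb_rc i o.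
have h3 := qb_rc (ordS i) o; have h4 := qb_rc (ordS (ordS i)) o.
rewrite !ordS3 in h3 h4.
have [_ [_ _ /(congr1 Num.conj)]] := orthonormal_complete h.
rewrite rmorph0 rmorph_sum (sum_ord3 i) !rmorphM /= => h5.
have eb : rr r = r i * (r i)^* + r (ordS i) * (r (ordS i))^*
  + r (ordS (ordS i)) * (r (ordS (ordS i)))^* by rewrite /rr (sum_ord3 i).
move: (r i)^* (r (ordS i))^* (r (ordS (ordS i)))^* h1 h2 h3 h4 h5 eb.
move: (qr q r)^* (rr r) => cc b s1 s2 s3 h1 h2 h3 h4 h5 eb.
apply: (linear_comb3 (k1 := b) (k2 := cc) (k3 := - 'i * s2) h1 h2 h4).
(* Substituting [qb_rc] for the two other indices turns the whole expression into r_i times the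
   conjugate of sum r_j^2. *)
suff: s1 * (b - (r i * s1 + r (ordS i) * s2 + r (ordS (ordS i)) * s3))
  + r i * (s1 * s1 + s2 * s2 + s3 * s3) + 'i * s3 *
  (q (ordS i) * b + r (ordS i) * cc -
    'i * (r (ordS (ordS i)) * s1 - r i * s3)) = 0.
  by move=> e; rewrite -[RHS]addr0 -[X in _ = _ + X]e; ring: ii.
by rewrite eb subrr -eb h3 h5 subrr !mulr0 !addr0.
Qed.

(** Up to a common real factor these are the coordinates of e_i = sqrt 2 W_i(e_0): those along l and
    k are real, and those along m and mbar are conjugate. *)
Lemma canonical_coords_real p q r i :
  orthonormal_triple p q r -> oriented_coords p q r -> rr r != 0 ->
  let b := rr r in let c := qr q r in let a := 2 + c * c^* / b in
  [/\ (- q i * a - p i * c)^* = - q i * a - p i * c,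
      (q i * b + r i * c^*)^* = q i * b + r i * c^* &
      (q i * c + r i * a)^* = - q i * c^* - p i * b].
Proof.
move=> h o b0 b c a; have yR := qb_rc_conj i o; have e := pb2_2qbc_rc2 i h o.
move: yR e; rewrite -/b -/c; set y := q i * b + r i * c^* => yR e.
have bR : b^* = b := rr_conj r.
(* All coordinates are expressed through the real number [y], the coordinate along k; those along m
   and mbar are then visibly conjugate. *)
have zE : q i * c + r i * a = c / b * y + 2 * r i by rewrite /a /y; field.
have wE : - q i * c^* - p i * b = c^* / b * y + 2 * (r i)^*.
  apply: (mulfI b0); rewrite -/b /y.
  apply: (linear_comb2 (k1 := -1) (k2 := 0) e (erefl 0)); field; exact: b0.
have xE : - q i * a - p i * c =
    b^-1 * (- 2 * y + 2 * (r i * c^* + (r i)^* * c) + c * c^* / b * y).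
  have -> : - q i * a - p i * c = b^-1 * (- 2 * q i * b + c * (- q i * c^* - p i * b)).
    by rewrite /a; field.
  by rewrite wE /y; field.
have {}b0 : b != 0 := b0; clearbody y a b c; split=> //.
  rewrite xE !(rmorphM, rmorphD, fmorphV, rmorphN, rmorph_nat) /= bR yR.
  by rewrite !conjCK; field.
by rewrite zE wE !(rmorphM, rmorphD, fmorphV, rmorph_nat) /= bR yR.
Qed.

End Triples.

(** * Null frames and the Pauli relations *)

Section Frame.
Variables (C : numClosedFieldType) (G : lorentz_data C).
Local Notation g := (gmx G).
Local Notation s := ((sqrtC 2)^-1 : C).

Definition formW (l k m : 'cV[C]_4) : 'M[C]_4 :=
  s *: (pwedge G l k + pwedge G m (cjmx m)).
Definition formU (l m : 'cV[C]_4) : 'M[C]_4 := - s *: pwedge G l (cjmx m).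
Definition formV (k m : 'cV[C]_4) : 'M[C]_4 := s *: pwedge G k m.

Record lorentz_frame := LorentzFrame {
  fl : 'cV[C]_4;
  fk : 'cV[C]_4;
  fm : 'cV[C]_4;
  fl_real : cjmx fl = fl;
  fk_real : cjmx fk = fk;
  fdot_lk : [/\ pdot G fl fl = 0, pdot G fk fk = 0 & pdot G fl fk = -1];
  fdot_m : [/\ pdot G fm fm = 0, pdot G fm (cjmx fm) = 1,
               pdot G fl fm = 0 & pdot G fk fm = 0];
  fself_dual : [/\ pself_dual G (formW fl fk fm), pself_dual G (formU fl fm)
                 & pself_dual G (formV fk fm)]
}.

Variable T : lorentz_frame.
Local Notation pW := (formW (fl T) (fk T) (fm T)).
Local Notation pU := (formU (fl T) (fm T)).
Local Notation pV := (formV (fk T) (fm T)).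

(** Locked, like [tform], so that rewriting stays in coordinates until [tvecE] or [tformE] is
    invoked. *)
Definition tvec (a b c d : C) : 'cV[C]_4 :=
  locked (a *: fl T + b *: fk T + c *: fm T + d *: cjmx (fm T)).
Definition tform (p q r : C) : 'M[C]_4 :=
  locked (p *: pU + q *: pW + r *: pV).

Local Notation app := (papp G).
Local Notation V := tvec.
Local Notation F := tform.
Implicit Types a b c d p q r : C.

Lemma sqrtC2_inv_sqr : s * s = 2^-1.
Proof. by rewrite -invfM -expr2 sqrtCK. Qed.

Lemma sqrtC2_neq0 : sqrtC 2 != 0 :> C.
Proof. by rewrite sqrtC_eq0 pnatr_eq0. Qed.

Lemma sqrtC2_inv_conj : s^* = s.
Proof. by apply/conj_Creal/ger0_real; rewrite invr_ge0 sqrtC_ge0 ler0n. Qed.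

(** Trades sqrt 2 for its inverse, so that s * s = 1/2 is the only relation needed afterwards. *)
Lemma sqrtC2_mul x : sqrtC 2 * x = 2 * s * x.
Proof.
congr (_ * _).
apply: (mulIf sqrtC2_neq0); rewrite -expr2 sqrtCK mulfVK //; exact: sqrtC2_neq0.
Qed.

Lemma tvecE a b c d :
  V a b c d = a *: fl T + b *: fk T + c *: fm T + d *: cjmx (fm T).
Proof. by rewrite /tvec -lock. Qed.

Lemma tformE p q r : F p q r = p *: pU + q *: pW + r *: pV.
Proof. by rewrite /tform -lock. Qed.

Lemma tvecD a b c d a' b' c' d' :
  V a b c d + V a' b' c' d' = V (a + a') (b + b') (c + c') (d + d').
Proof. by rewrite !tvecE; apply/matrixP => i j; rewrite !mxE; ring. Qed.

Lemma tvecZ k a b c d : k *: V a b c d = V (k * a) (k * b) (k * c) (k * d).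
Proof. by rewrite !tvecE; apply/matrixP => i j; rewrite !mxE; ring. Qed.

Lemma tvecN a b c d : - V a b c d = V (- a) (- b) (- c) (- d).
Proof. by rewrite !tvecE; apply/matrixP => i j; rewrite !mxE; ring. Qed.

Lemma tformD p q r p' q' r' : F p q r + F p' q' r' = F (p + p') (q + q') (r + r').
Proof.
rewrite !tformE; move: (pU) (pW) (pV) => X Y Z.
by apply/matrixP => i j; rewrite !mxE; ring.
Qed.

Lemma tformZ k p q r : k *: F p q r = F (k * p) (k * q) (k * r).
Proof.
rewrite !tformE; move: (pU) (pW) (pV) => X Y Z.
by apply/matrixP => i j; rewrite !mxE; ring.
Qed.

Lemma tform_U : pU = F 1 0 0.
Proof.
rewrite !tformE; move: (pU) (pW) (pV) => X Y Z.
by apply/matrixP => i j; rewrite !mxE; ring.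
Qed.
Lemma tform_W : pW = F 0 1 0.
Proof.
rewrite !tformE; move: (pU) (pW) (pV) => X Y Z.
by apply/matrixP => i j; rewrite !mxE; ring.
Qed.
Lemma tform_V : pV = F 0 0 1.
Proof.
rewrite !tformE; move: (pU) (pW) (pV) => X Y Z.
by apply/matrixP => i j; rewrite !mxE; ring.
Qed.

Lemma tvec_conj a b c d : cjmx (V a b c d) = V a^* b^* d^* c^*.
Proof.
have l := fl_real T; have k := fk_real T.
by rewrite !tvecE !cjmxD !cjmxZ cjmxK l k addrAC.
Qed.

Lemma tvec_dot a b c d a' b' c' d' :
  pdot G (V a b c d) (V a' b' c' d') = - (a * b' + b * a') + (c * d' + d * c').
Proof.
case: (fdot_lk T) => ll kk lk; case: (fdot_m T) => mm mmb lm km.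
have l := fl_real T; have k := fk_real T.
have bb : pdot G (cjmx (fm T)) (cjmx (fm T)) = 0.
  by rewrite pdot_conj mm rmorph0.
have lb : pdot G (fl T) (cjmx (fm T)) = 0.
  by rewrite -{1}l pdot_conj lm rmorph0.
have kb : pdot G (fk T) (cjmx (fm T)) = 0.
  by rewrite -{1}k pdot_conj km rmorph0.
rewrite !tvecE !(pdotDl, pdotDr, pdotZl, pdotZr).
rewrite (pdotC G (fk T) (fl T)) !(pdotC G (fm T) (fl T)) !(pdotC G (fm T) (fk T)).
rewrite !(pdotC G (cjmx _) (fl T)) !(pdotC G (cjmx _) (fk T)).
rewrite (pdotC G (cjmx _) (fm T)).
by rewrite ll kk lk mm mmb lm km bb lb kb; ring.
Qed.

Lemma tvec_l : fl T = V 1 0 0 0.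
Proof. by rewrite tvecE; apply/matrixP => i j; rewrite !mxE; ring. Qed.
Lemma tvec_k : fk T = V 0 1 0 0.
Proof. by rewrite tvecE; apply/matrixP => i j; rewrite !mxE; ring. Qed.
Lemma tvec_m : fm T = V 0 0 1 0.
Proof. by rewrite tvecE; apply/matrixP => i j; rewrite !mxE; ring. Qed.

Lemma tvec_inj a b c d a' b' c' d' : V a b c d = V a' b' c' d' ->
  [/\ a = a', b = b', c = c' & d = d'].
Proof.
move=> e; have D x y z w := congr1 (pdot G (V x y z w)) e.
move: (D 1 0 0 0) (D 0 1 0 0) (D 0 0 1 0) (D 0 0 0 1); rewrite !tvec_dot => h1 h2 h3 h4.
by split; [apply: (linear_comb1 (k := -1) h2) | apply: (linear_comb1 (k := -1) h1)
  | apply: (linear_comb1 (k := 1) h4) | apply: (linear_comb1 (k := 1) h3)]; ring.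
Qed.

Lemma tvec_span v : exists a b c d, v = V a b c d.
Proof.
pose t j := tnth [tuple fl T; fk T; fm T; cjmx (fm T)] j.
have tE x : \sum_j x j *: t j = V (x 0) (x 1) (x 2) (x 3).
  rewrite !big_ord_recl big_ord0 addr0 !addrA tvecE; congr (_ *: _ + _ *: _ + _ *: _ + _ *: _);
  by congr (x _); apply/val_inj.
have free_t x : \sum_j x j *: t j = 0 -> forall j, x j = 0.
  rewrite tE; have -> : 0 = V 0 0 0 0.
    by rewrite tvecE; apply/matrixP => i j; rewrite !mxE; ring.
  case/tvec_inj => x0 x1 x2 x3 [[|[|[|[|j]]]] Hj] //.
  - by have -> : Ordinal Hj = 0 by exact/val_inj.
  - by have -> : Ordinal Hj = 1 by exact/val_inj.
  - by have -> : Ordinal Hj = 2 by exact/val_inj.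
  - by have -> : Ordinal Hj = 3 by exact/val_inj.
have [x ->] := span4 free_t v.
by exists (x 0), (x 1), (x 2), (x 3); rewrite tE.
Qed.

Lemma app_tform_tvec p q r a b c d : app (F p q r) (V a b c d) =
  s *: V (- q * a - p * c) (q * b + r * d) (q * c + r * a) (- q * d - p * b).
Proof.
have mb : cjmx (fm T) = V 0 0 0 1.
  by rewrite tvecE; apply/matrixP => i j; rewrite !mxE; ring.
rewrite tformE 2!pappDl 3!pappZl.
have -> v : app pU v = - s *: (pdot G (cjmx (fm T)) v *: fl T - pdot G (fl T) v *: cjmx (fm T)).
  by rewrite pappZl papp_wedge.
have -> v : app pV v = s *: (pdot G (fm T) v *: fk T - pdot G (fk T) v *: fm T).
  by rewrite pappZl papp_wedge.
have -> v : app pW v = s *: (pdot G (fk T) v *: fl T - pdot G (fl T) v *: fk T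
  + (pdot G (cjmx (fm T)) v *: fm T - pdot G (fm T) v *: cjmx (fm T))).
  by rewrite pappZl pappDl !papp_wedge.
rewrite mb tvec_l tvec_k tvec_m.
rewrite !tvec_dot.
rewrite -!scaleN1r.
rewrite !(tvecZ, tvecD).
congr (tvec _ _ _ _); ring.
Qed.

Lemma tvec_form_inj X Y : (forall a b c d, app X (V a b c d) = app Y (V a b c d)) -> X = Y.
Proof.
by move=> e; apply: papp_inj => v; have [a [b [c [d ->]]]] := tvec_span v.
Qed.

Lemma tform_asym p q r : (F p q r)^T = - F p q r.
Proof.
have aZ k (X : 'M[C]_4) : X^T = - X -> (k *: X)^T = - (k *: X).
  by move=> e; rewrite linearZ /= e scalerN.
have aD (X Y : 'M[C]_4) : X^T = - X -> Y^T = - Y -> (X + Y)^T = - (X + Y).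
  by move=> eX eY; rewrite linearD /= eX eY opprD.
rewrite tformE; apply: (aD); first apply: (aD); apply: (aZ); apply: (aZ);
  try exact: pwedge_asym.
by apply: (aD); exact: pwedge_asym.
Qed.

Lemma tform_self_dual p q r : pself_dual G (F p q r).
Proof.
case: (fself_dual T) => hW hU hV; rewrite tformE.
exact: pself_dualD (pself_dualD (pself_dualZ p hU) (pself_dualZ q hW)) (pself_dualZ r hV).
Qed.

(** The quaternionic product rule: the symmetric part is -1/2 (A, B) times the metric, and the
    antisymmetric part, half the commutator, is again self-dual. Taking the trace yields the scalar
    product in [tform_ip]. *)
Lemma tform_mul p q r p' q' r' : pmul G (F p q r) (F p' q' r') =
  (2^-1 * (q * q' - 2^-1 * (p * r' + r * p'))) *: g
  + s *: F (p * q' - q * p') (2^-1 * (p * r' - r * p')) (q * r' - r * q').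
Proof.
apply: tvec_form_inj => a b c d.
rewrite papp_mul pappDl !pappZl papp_metric !app_tform_tvec.
rewrite pappZr app_tform_tvec !scalerA sqrtC2_inv_sqr !tvecZ tvecD.
by congr (tvec _ _ _ _); field.
Qed.

Lemma tform_ip p q r p' q' r' : pip G (F p q r) (F p' q' r') =
  2^-1 * (p * r' + r * p') - q * q'.
Proof.
rewrite pip_mul ?tform_asym // tform_mul mulmxDl mxtraceD -!scalemxAl.
rewrite mulmxV ?(gmx_unit G) // !linearZ /= mxtrace1 tr_asym ?tform_asym //.
by rewrite mulr0; field.
Qed.

Lemma tform_inj p q r p' q' r' : F p q r = F p' q' r' -> [/\ p = p', q = q' & r = r'].
Proof.
move=> e; have D x y z := congr1 (pip G (F x y z)) e.
move: (D 1 0 0) (D 0 1 0) (D 0 0 1); rewrite !tform_ip => h1 h2 h3.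
by split; [apply: (linear_comb1 (k := 2) h3) | apply: (linear_comb1 (k := -1) h2)
  | apply: (linear_comb1 (k := 2) h1)]; field.
Qed.

End Frame.

(** * Orthonormal frames and null tetrads generated by a Pauli triple and a real unit time-like
    vector *)

Section PauliTriple.
Variables (C : numClosedFieldType) (G : lorentz_data C).
Local Notation g := (gmx G).
Local Notation s := ((sqrtC 2)^-1 : C).

(** The multiplication table of the matrices - sigma_i / sqrt 2. [pauli_mul] is the cyclic form of
    the orientation condition W_3 = i sqrt 2 W_1 x W_2. *)
Record pauli_triple (W : 'I_3 -> 'M[C]_4) : Prop := PauliTriple {
  pauli_sd : forall i, pself_dual G (W i);
  pauli_sqr : forall i, pmul G (W i) (W i) = 2^-1 *: g;
  pauli_mul : forall i,
    pmul G (W i) (W (ordS i)) = (- ('i * s)) *: W (ordS (ordS i));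
  pauli_mulr : forall i,
    pmul G (W (ordS i)) (W i) = ('i * s) *: W (ordS (ordS i))
}.

Variables (W : 'I_3 -> 'M[C]_4) (e0 : 'cV[C]_4) (e : 'I_3 -> 'cV[C]_4).
Hypothesis pauliW : pauli_triple W.
Hypothesis eE : forall i, e i = sqrtC 2 *: papp G (W i) e0.
Hypothesis e0_real : cjmx e0 = e0.
Hypothesis e0_unit : pdot G e0 e0 = -1.
Hypothesis e_real : forall i, cjmx (e i) = e i.

Let ii : 'i * 'i = -1 :> C. Proof. by rewrite -expr2 sqrCi. Qed.
Let ss : s * s = 2^-1. Proof. exact: sqrtC2_inv_sqr. Qed.
Let s2 : sqrtC 2 = 2 * s :> C.
Proof. by have := sqrtC2_mul (1 : C); rewrite !mulr1. Qed.

(** This and the next three lemmas show W_i as a boost in the plane of e_0, e_i plus i times a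
    rotation in the plane of e_j, e_k, both scaled by 1 / sqrt 2. *)
Lemma pauli_app0 i : papp G (W i) e0 = s *: e i.
Proof. by rewrite eE scalerA mulVf ?scale1r // sqrtC2_neq0. Qed.

Lemma pauli_app_diag i : papp G (W i) (e i) = s *: e0.
Proof.
rewrite eE pappZr -papp_mul (pauli_sqr pauliW) pappZl papp_metric scalerA sqrtC2_mul.
by congr (_ *: _); move: (sqrtC 2)^-1 => t; field.
Qed.

Lemma pauli_app_succ i : papp G (W i) (e (ordS i)) = (- 'i * s) *: e (ordS (ordS i)).
Proof.
rewrite eE pappZr -papp_mul (pauli_mul pauliW) pappZl pauli_app0 !scalerA.
congr (_ *: _); rewrite sqrtC2_mul; move: (sqrtC 2)^-1 ss => t tt.
by apply: (linear_comb1 (k := - 2 * 'i * t) tt); field.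
Qed.

Lemma pauli_app_pred i : papp G (W i) (e (ordS (ordS i))) = ('i * s) *: e (ordS i).
Proof.
have := pauli_mulr pauliW (ordS (ordS i)); rewrite ordS3 => m.
rewrite eE pappZr -papp_mul m pappZl pauli_app0 !scalerA.
congr (_ *: _); rewrite sqrtC2_mul; move: (sqrtC 2)^-1 ss => t tt.
by apply: (linear_comb1 (k := 2 * 'i * t) tt); field.
Qed.

Lemma pauli_conj_app0 i : papp G (cjmx (W i)) e0 = s *: e i.
Proof. by rewrite papp_conj e0_real pauli_app0 cjmxZ e_real sqrtC2_inv_conj. Qed.

Lemma pauli_conj_app_diag i : papp G (cjmx (W i)) (e i) = s *: e0.
Proof. by rewrite papp_conj e_real pauli_app_diag cjmxZ e0_real sqrtC2_inv_conj. Qed.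

Lemma pauli_conj_app_succ i :
  papp G (cjmx (W i)) (e (ordS i)) = ('i * s) *: e (ordS (ordS i)).
Proof.
rewrite papp_conj e_real pauli_app_succ cjmxZ e_real rmorphM rmorphN /= conjCi.
by rewrite sqrtC2_inv_conj opprK.
Qed.

Lemma pauli_conj_app_pred i :
  papp G (cjmx (W i)) (e (ordS (ordS i))) = (- 'i * s) *: e (ordS i).
Proof.
rewrite papp_conj e_real pauli_app_pred cjmxZ e_real rmorphM /= conjCi.
by rewrite sqrtC2_inv_conj.
Qed.

Lemma pauli_asym i : (W i)^T = - W i.
Proof. by case: (pauli_sd pauliW i). Qed.

Lemma pauli_dot0 i : pdot G e0 (e i) = 0.
Proof.
have : pdot G e0 (papp G (W i) e0) = - pdot G e0 (papp G (W i) e0).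
  by rewrite {1}pdot_app ?pauli_asym // pdotC.
move/eqP; rewrite -addr_eq0 -mulr2n mulrn_eq0 /= => /eqP h.
by rewrite eE pdotZr h mulr0.
Qed.

Lemma pauli_dot_app i x : pdot G (e i) x = - pdot G e0 (sqrtC 2 *: papp G (W i) x).
Proof. by rewrite eE !pdotZr pdot_app ?pauli_asym // mulrN opprK pdotZl. Qed.

(** Skew symmetry moves W_i from e_i onto e_j; the result is a multiple of e_0 when i = j and of a
    spatial vector, orthogonal to e_0, otherwise. *)
Lemma pauli_dot i j : pdot G (e i) (e j) = (i == j)%:R.
Proof.
rewrite pauli_dot_app; have [n1 n2 n3] := ordS_neq i; rewrite eq_sym in n3.
case: (ord3_cases i j) => ->.
- rewrite eqxx pauli_app_diag scalerA mulfV ?sqrtC2_neq0 // scale1r.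
  by rewrite e0_unit opprK.
- by rewrite (negPf n1) pauli_app_succ !pdotZr pauli_dot0 !mulr0 oppr0.
- by rewrite (negPf n3) pauli_app_pred !pdotZr pauli_dot0 !mulr0 oppr0.
Qed.

Lemma pauli_span v : exists x0 x, v = x0 *: e0 + \sum_i x i *: e i.
Proof.
pose t j := if unlift ord0 j is Some i then e i else e0.
have tE x : \sum_(j < 4) x j *: t j = x ord0 *: e0 + \sum_i x (lift ord0 i) *: e i.
  rewrite big_ord_recl /t unlift_none; congr (_ + _).
  by apply: eq_bigr => i _; rewrite liftK.
have free_t x : \sum_j x j *: t j = 0 -> forall j, x j = 0.
  rewrite tE => x0.
  have dsum y : pdot G y (\sum_i x (lift ord0 i) *: e i)
      = \sum_i x (lift ord0 i) * pdot G y (e i).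
    by rewrite !(sum_ord3 0) !pdotDr !pdotZr.
  have d0 : x ord0 = 0.
    move/(congr1 (pdot G e0)): x0; rewrite pdotDr pdotZr e0_unit dsum.
    rewrite big1 => [|i _]; last by rewrite pauli_dot0 mulr0.
    rewrite pdot0r addr0 mulrN1 => /eqP.
    by rewrite oppr_eq0 => /eqP.
  move=> j; case: (unliftP ord0 j) => [i|] ->; last by [].
  move/(congr1 (pdot G (e i))): x0.
  rewrite pdotDr pdotZr pdotC pauli_dot0 mulr0 add0r dsum (sum_ord3 i).
  have [n1 n2 n3] := ordS_neq i; rewrite eq_sym in n3.
  rewrite !pauli_dot eqxx (negPf n1) (negPf n3) mulr1 !mulr0 !addr0 => ->.
  exact: pdot0r.
have [x ->] := span4 free_t v.
by exists (x ord0), (fun i => x (lift ord0 i)).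
Qed.

Lemma pauli_form_inj X Y : papp G X e0 = papp G Y e0 ->
  (forall i, papp G X (e i) = papp G Y (e i)) -> X = Y.
Proof.
move=> h0 h; apply: (@papp_inj _ G) => v; have [x0 [x ->]] := pauli_span v.
by rewrite (sum_ord3 0) !pappDr !pappZr h0 !h.
Qed.

Lemma pauli_form_inj3 i X Y : papp G X e0 = papp G Y e0 ->
  papp G X (e i) = papp G Y (e i) ->
  papp G X (e (ordS i)) = papp G Y (e (ordS i)) ->
  papp G X (e (ordS (ordS i))) = papp G Y (e (ordS (ordS i))) -> X = Y.
Proof.
move=> h0 h1 h2 h3; apply: pauli_form_inj => // j.
by case: (ord3_cases i j) => ->.
Qed.

(** As the frame is real, conjugation keeps the boost part of W_i and reverses the rotation part.
    The sum isolates the former, the difference in [pauli_subC] the latter. *)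
Lemma pauli_addC i : W i + cjmx (W i) = sqrtC 2 *: pwedge G e0 (e i).
Proof.
have [n1 n2 n3] := ordS_neq i; rewrite eq_sym in n3.
apply: (@pauli_form_inj3 i); rewrite pappDl pappZl papp_wedge.
- by rewrite pauli_app0 pauli_conj_app0 pdotC pauli_dot0 e0_unit
    scale0r sub0r scaleN1r opprK -scalerDl; congr (_ *: _); move: (sqrtC 2) (sqrtC 2)^-1 s2 => u t ->; ring.
- by rewrite pauli_app_diag pauli_conj_app_diag pauli_dot0 pauli_dot eqxx
    scale0r subr0 scale1r -scalerDl; congr (_ *: _); move: (sqrtC 2) (sqrtC 2)^-1 s2 => u t ->; ring.
- rewrite pauli_app_succ pauli_conj_app_succ pauli_dot0 pauli_dot (negPf n1).
  by rewrite !scale0r subr0 scaler0 mulNr scaleNr addNr.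
- rewrite pauli_app_pred pauli_conj_app_pred pauli_dot0 pauli_dot (negPf n3).
  by rewrite !scale0r subr0 scaler0 mulNr scaleNr addrN.
Qed.

Lemma pauli_subC i :
  W i - cjmx (W i) = ('i * sqrtC 2) *: pwedge G (e (ordS i)) (e (ordS (ordS i))).
Proof.
have [n1 n2 n3] := ordS_neq i.
apply: (@pauli_form_inj3 i); rewrite pappDl pappNl pappZl papp_wedge.
- rewrite pauli_app0 pauli_conj_app0 !(pdotC G _ e0) !pauli_dot0.
  by rewrite !scale0r subr0 scaler0 subrr.
- rewrite pauli_app_diag pauli_conj_app_diag !pauli_dot (negPf n3) eq_sym (negPf n1).
  by rewrite !scale0r subr0 scaler0 subrr.
- rewrite pauli_app_succ pauli_conj_app_succ !pauli_dot eqxx eq_sym (negPf n2).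
  rewrite scale0r sub0r scale1r scalerN -!scaleNr -scalerDl.
  by congr (_ *: _); move: (sqrtC 2) (sqrtC 2)^-1 s2 => u t ->; ring.
- rewrite pauli_app_pred pauli_conj_app_pred !pauli_dot eqxx (negPf n2).
  by rewrite scale0r subr0 scale1r -!scaleNr -scalerDl; congr (_ *: _);
    move: (sqrtC 2) (sqrtC 2)^-1 s2 => u t ->; ring.
Qed.

Lemma pauli_wedge i : W i = s *: (pwedge G e0 (e i)
  + 'i *: pwedge G (e (ordS i)) (e (ordS (ordS i)))).
Proof.
have e1 : 2 *: W i = sqrtC 2 *: pwedge G e0 (e i)
   + ('i * sqrtC 2) *: pwedge G (e (ordS i)) (e (ordS (ordS i))).
  by rewrite -pauli_addC -pauli_subC addrACA subrr addr0 scaler_nat mulr2n.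
apply: (scalerI (a := 2)); first by rewrite pnatr_eq0.
rewrite {}e1; move: (pwedge _ _ _) (pwedge _ _ _) => X Y.
move: (sqrtC 2) (sqrtC 2)^-1 s2 => u t ->.
by apply/matrixP => a b; rewrite !mxE; ring.
Qed.

(** The volume element is not evaluated: the dual acts as i on W_i and, being real, as -i on
    conj(W_i), and e_0 /\ e_i is proportional to their sum. *)
Lemma pauli_canonical i : W i = s *: (pwedge G e0 (e i) - 'i *: star G (pwedge G e0 (e i))).
Proof.
have wE : pwedge G e0 (e i) = s *: (W i + cjmx (W i)).
  by rewrite pauli_addC scalerA mulVf ?scale1r // sqrtC2_neq0.
have hW : star G (W i) = 'i *: W i by case: (pauli_sd pauliW i).
rewrite wE starZ starD star_conj hW cjmxZ conjCi.
move: (W i) (cjmx (W i)) => X Y.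
rewrite !(scalerDr, scalerBr) !scalerA !scalerN.
move: (sqrtC 2)^-1 ss => t tt.
apply/matrixP => a b; rewrite !mxE.
by apply: (linear_comb2 (k1 := - 2 * X a b) (k2 := t * t * (X a b - Y a b)) tt ii); field.
Qed.

Definition pauli_l i : 'cV[C]_4 := s *: (e0 + e i).
Definition pauli_k i : 'cV[C]_4 := s *: (e0 - e i).
Definition pauli_m i : 'cV[C]_4 := s *: (e (ordS i) + 'i *: e (ordS (ordS i))).

Lemma pauli_m_conj i :
  cjmx (pauli_m i) = s *: (e (ordS i) + (- 'i) *: e (ordS (ordS i))).
Proof. by rewrite /pauli_m cjmxZ cjmxD cjmxZ !e_real conjCi sqrtC2_inv_conj. Qed.

Lemma pauli_kE i : pauli_k i = s *: (e0 + (-1) *: e i).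
Proof. by rewrite scaleN1r. Qed.

(** The sign comes from l /\ k = - e_0 /\ e_i and m /\ mbar = - i e_j /\ e_k. *)
Lemma pauli_formW i : formW G (pauli_l i) (pauli_k i) (pauli_m i) = - W i.
Proof.
rewrite /formW pauli_m_conj pauli_kE !pwedge_pairs !pwedgeZr !pwedgeZl !pwedge_self.
rewrite pauli_wedge (pwedgeC G (e i) e0) (pwedgeC G (e (ordS (ordS i))) (e (ordS i))).
move: (pwedge G e0 _) (pwedge G (e (ordS i)) _) => X Y.
move: (sqrtC 2)^-1 ss => t tt; apply/matrixP => a b; rewrite !mxE.
by apply: (linear_comb1 (k := - 2 * t * (X a b + 'i * Y a b)) tt); field.
Qed.

Lemma pauli_formU i : formU G (pauli_l i) (pauli_m i) =
  - 2^-1 *: (W (ordS i) - 'i *: W (ordS (ordS i))).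
Proof.
rewrite /formU pauli_m_conj pwedge_pairs !pwedgeZr.
rewrite !pauli_wedge !ordS3 (pwedgeC G (e (ordS (ordS i))) (e i)).
move: (pwedge G e0 (e (ordS i))) (pwedge G e0 (e (ordS (ordS i))))
  (pwedge G (e i) (e (ordS i))) (pwedge G (e i) (e (ordS (ordS i)))) => X Y Z U.
move: (sqrtC 2)^-1 ss => t tt; apply/matrixP => a b; rewrite !mxE.
by apply: (linear_comb2 (k1 := - t * (X a b - 'i * Y a b + Z a b - 'i * U a b))
  (k2 := - 2^-1 * t * Z a b) tt ii); field.
Qed.

Lemma pauli_formV i : formV G (pauli_k i) (pauli_m i) =
  2^-1 *: (W (ordS i) + 'i *: W (ordS (ordS i))).
Proof.
rewrite /formV pauli_kE pwedge_pairs !pwedgeZl !pwedgeZr.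
rewrite !pauli_wedge !ordS3 (pwedgeC G (e (ordS (ordS i))) (e i)).
move: (pwedge G e0 (e (ordS i))) (pwedge G e0 (e (ordS (ordS i))))
  (pwedge G (e i) (e (ordS i))) (pwedge G (e i) (e (ordS (ordS i)))) => X Y Z U.
move: (sqrtC 2)^-1 ss => t tt; apply/matrixP => a b; rewrite !mxE.
by apply: (linear_comb2 (k1 := t * (X a b + 'i * Y a b - Z a b - 'i * U a b))
  (k2 := - 2^-1 * t * Z a b) tt ii); field.
Qed.

Lemma pauli_frame_dots i :
  [/\ [/\ pdot G (pauli_l i) (pauli_l i) = 0, pdot G (pauli_k i) (pauli_k i) = 0 &
         pdot G (pauli_l i) (pauli_k i) = -1],
      pdot G (pauli_m i) (pauli_m i) = 0,
      pdot G (pauli_m i) (cjmx (pauli_m i)) = 1,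
      pdot G (pauli_l i) (pauli_m i) = 0 & pdot G (pauli_k i) (pauli_m i) = 0].
Proof.
have [n1 n2 n3] := ordS_neq i.
have dE a b c d j k : pdot G (a *: e0 + b *: e j) (c *: e0 + d *: e k)
    = - (a * c) + b * d * (j == k)%:R.
  rewrite !(pdotDl, pdotDr, pdotZl, pdotZr) e0_unit (pdotC G _ e0) !pauli_dot0.
  by rewrite pauli_dot; ring.
have dm a b c j k l : pdot G (a *: e0 + b *: e j) (e k + c *: e l)
    = b * (j == k)%:R + b * c * (j == l)%:R.
  by rewrite !(pdotDl, pdotDr, pdotZl, pdotZr) !pauli_dot0 !pauli_dot; ring.
have mm a b j k : j != k -> pdot G (e j + a *: e k) (e j + b *: e k) = 1 + a * b.
  move=> njk; rewrite !(pdotDl, pdotDr, pdotZl, pdotZr) !pauli_dot !eqxx.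
  by rewrite (eq_sym k j) (negPf njk) /=; ring.
have lE : pauli_l i = s *: (1 *: e0 + 1 *: e i) by rewrite !scale1r.
have kE : pauli_k i = s *: (1 *: e0 + (-1) *: e i) by rewrite scale1r scaleN1r.
have n3' : (i == ordS (ordS i)) = false by rewrite eq_sym (negPf n3).
rewrite pauli_m_conj lE kE /pauli_m; move: (sqrtC 2)^-1 ss => t tt.
do ![split]; rewrite pdotZl pdotZr ?dE ?dm ?mm // ?eqxx ?(negPf n1) ?n3' /=.
- by ring.
- by ring.
- by apply: (linear_comb1 (k := - 2) tt); field.
- by apply: (linear_comb1 (k := t * t) ii); ring.
- by apply: (linear_comb2 (k1 := 2) (k2 := - t * t) tt ii); field.
- by ring.
- by ring.
Qed.

Lemma pauli_frame_self_dual i :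
  [/\ pself_dual G (formW G (pauli_l i) (pauli_k i) (pauli_m i)),
      pself_dual G (formU G (pauli_l i) (pauli_m i)) &
      pself_dual G (formV G (pauli_k i) (pauli_m i))].
Proof.
have sd j : pself_dual G (W j) := pauli_sd pauliW j.
rewrite pauli_formW pauli_formU pauli_formV; split.
- by rewrite -scaleN1r; apply: pself_dualZ.
- by apply: pself_dualZ; apply: pself_dualD => //; rewrite -scaleNr; apply: pself_dualZ.
- by apply: pself_dualZ; apply: pself_dualD => //; apply: pself_dualZ.
Qed.

Lemma pauli_lk_real i : cjmx (pauli_l i) = pauli_l i /\ cjmx (pauli_k i) = pauli_k i.
Proof. by rewrite !cjmxZ !cjmxD cjmxN e0_real e_real sqrtC2_inv_conj. Qed.

Lemma pauli_lk_future i : pdot G e0 (pauli_l i) < 0 /\ pdot G e0 (pauli_k i) < 0.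
Proof.
rewrite !pdotZr !pdotDr pdotNr e0_unit pauli_dot0 oppr0 addr0 mulrN1 oppr_lt0.
by rewrite invr_gt0 sqrtC_gt0 ltr0n.
Qed.

End PauliTriple.

(** * The canonical vector in null-frame coordinates *)

Section Coordinates.
Variables (C : numClosedFieldType) (G : lorentz_data C) (T : lorentz_frame G).
Local Notation s := ((sqrtC 2)^-1 : C).
Local Notation V := (tvec T).
Local Notation F := (tform T).

Let ii : 'i * 'i = -1 :> C. Proof. by rewrite -expr2 sqrCi. Qed.

Lemma coords_pauli (p q r : 'I_3 -> C) :
  orthonormal_triple p q r -> oriented_coords p q r ->
  pauli_triple G (fun i => F (p i) (q i) (r i)).
Proof.
move=> h o.
have mulE x : s * x = - ('i * s) * ('i * x).
  by apply: (linear_comb1 (k := s * x) ii); ring.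
have mulrE x y : y = - x -> s * y = 'i * s * ('i * x).
  by move=> ->; apply: (linear_comb1 (k := - s * x) ii); ring.
split=> i; first exact: tform_self_dual.
- have := h i i; rewrite eqxx /= => hi; rewrite tform_mul.
  have -> : F (p i * q i - q i * p i) (2^-1 * (p i * r i - r i * p i))
      (q i * r i - r i * q i) = 0.
    by rewrite tformE; apply/matrixP => a b; rewrite !mxE; ring.
  rewrite scaler0 addr0; congr (_ *: _).
  by apply: (linear_comb1 (k := - 2^-1) hi); field.
- have [n1 _ _] := ordS_neq i; have := h i (ordS i); rewrite (negPf n1) /= => hi.
  have [e1 e2 e3] := o i; rewrite tform_mul e1 e2 e3 !tformZ.
  have -> : 2^-1 * (q i * q (ordS i) - 2^-1 * (p i * r (ordS i) + r i * p (ordS i))) = 0.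
    by apply: (linear_comb1 (k := - 2^-1) hi); field.
  rewrite scale0r add0r; by congr (tform _ _ _ _); exact: mulE.
- have [n1 _ _] := ordS_neq i; have := h i (ordS i); rewrite (negPf n1) /= => hi.
  have [e1 e2 e3] := o i; rewrite tform_mul e1 e2 e3 !tformZ.
  have -> : 2^-1 * (q (ordS i) * q i - 2^-1 * (p (ordS i) * r i + r (ordS i) * p i)) = 0.
    by apply: (linear_comb1 (k := - 2^-1) hi); field.
  rewrite scale0r add0r; by congr (tform _ _ _ _); apply: mulrE; ring.
Qed.

Lemma rr_ge0 (r : 'I_3 -> C) : 0 <= rr r.
Proof. by apply: sumr_ge0 => i _; apply: mul_conjC_ge0. Qed.

(** If every r_i vanished, the completeness relation sum p_i r_i = -2 would fail. This makes the
    division by b legitimate. *)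
Lemma rr_neq0 (p q r : 'I_3 -> C) : orthonormal_triple p q r -> rr r != 0.
Proof.
move=> h; apply/eqP => /eqP; rewrite psumr_eq0; last by move=> i _; apply: mul_conjC_ge0.
move/allP => r0; have [[_ _ /eqP]] := orthonormal_complete h.
rewrite big1 => [|i _]; first by rewrite eq_sym oppr_eq0 pnatr_eq0.
have := r0 i (mem_index_enum i); rewrite mul_conjC_eq0 => /eqP ->.
by rewrite mulr0.
Qed.

Section CanonicalVector.
Variables p q r : 'I_3 -> C.
Hypothesis orth : orthonormal_triple p q r.
Hypothesis orient : oriented_coords p q r.
Let b := rr r.
Let c := qr q r.
Let a := 2 + c * c^* / b.
Let e0 := (2 * sqrtC b)^-1 *: V a b c c^*.
Let k := (2 * sqrtC b)^-1.

Let b_neq0 : b != 0. Proof. exact: rr_neq0 orth. Qed.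
Let b_conj : b^* = b. Proof. exact: rr_conj. Qed.
Let k_conj : k^* = k.
Proof.
apply/conj_Creal/ger0_real; rewrite invr_ge0 mulr_ge0 ?ler0n //.
by rewrite sqrtC_ge0 rr_ge0.
Qed.
Let kk : k * k = (4 * b)^-1.
Proof.
rewrite /k -invfM; congr (_^-1); have := sqrtCK b.
by move: (sqrtC b) => t tt; apply: (linear_comb1 (k := 4) tt); ring.
Qed.
Let a_conj : a^* = a.
Proof.
rewrite /a rmorphD rmorphM /= rmorphM fmorphV rmorph_nat /= conjCK b_conj.
by rewrite (mulrC c).
Qed.

Lemma canonical_real : cjmx e0 = e0.
Proof.
by rewrite cjmxZ tvec_conj conjCK a_conj b_conj [X in X *: _]k_conj.
Qed.

Lemma canonical_unit : pdot G e0 e0 = -1.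
Proof.
rewrite pdotZl pdotZr tvec_dot mulrA [X in X * _]kk /a.
by field.
Qed.

Lemma canonical_ei_real i :
  cjmx (sqrtC 2 *: papp G (F (p i) (q i) (r i)) e0) =
  sqrtC 2 *: papp G (F (p i) (q i) (r i)) e0.
Proof.
rewrite pappZr app_tform_tvec !scalerA.
have -> : sqrtC 2 * (2 * sqrtC b)^-1 * s = k.
  rewrite mulrAC mulfV ?mul1r //; exact: sqrtC2_neq0.
rewrite cjmxZ k_conj tvec_conj; congr (_ *: _).
have [x y z] := canonical_coords_real i orth orient b_neq0.
rewrite -/b -/c -/a in x y z.
by rewrite x y z -{1}[q i * c + r i * a]conjCK z.
Qed.

End CanonicalVector.
End Coordinates.

(** * Eigenvectors of the self-dual Weyl tensor *)

Section Spectral.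
Variable C : numClosedFieldType.
Variables P0 P1 P2 P3 P4 : C.

Let ii : 'i * 'i = -1 :> C. Proof. by rewrite -expr2 sqrCi. Qed.

(** The equation C(X) = x X in the coordinates along U, W, V. The products (U, V) = 1/2 and (W, W) =
    -1, doubled by the 1/2 in front of C, exchange p with r and give q the factor -2. *)
Definition eigen_coords (x p q r : C) : Prop :=
  [/\ P0 * r - 2 * P1 * q + P2 * p = x * p,
      P1 * r - 2 * P2 * q + P3 * p = x * q &
      P2 * r - 2 * P3 * q + P4 * p = x * r].

Definition invI_of : C := P0 * P4 - 4 * P1 * P3 + 3 * P2 ^+ 2.
Definition invJ_of : C :=
  P0 * P2 * P4 + 2 * P1 * P2 * P3 - P2 ^+ 3 - P0 * P3 ^+ 2 - P1 ^+ 2 * P4.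
Definition coefA_of (x : C) : C :=
  P0 * P4 + P2 ^+ 2 - 2 * P1 * P3 + x * P2 + (x ^+ 2 - invI_of).
Definition coefB_of (x : C) : C := P1 * P4 - P2 * P3 + P3 * x.
Definition coefC_of (x : C) : C := 2 * P2 * P4 - 2 * P3 ^+ 2 + x * P4.
Definition coefD_of (x : C) : C := 2^-1 * (invI_of - 3 * x ^+ 2).

Lemma sum3_scale (u v w : 'I_3 -> C) (k1 k2 k3 : C) :
  \sum_i (k1 * u i + k2 * v i + k3 * w i) =
  k1 * (\sum_i u i) + k2 * (\sum_i v i) + k3 * (\sum_i w i).
Proof. by rewrite !(sum_ord3 0); ring. Qed.

Lemma sum3_lin (z x y1 y2 y3 : 'I_3 -> C) (k1 k2 k3 : C) :
    (forall j, z j = k1 * y1 j + k2 * y2 j + k3 * y3 j) ->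
    \sum_j x j * z j =
    k1 * (\sum_j x j * y1 j) + k2 * (\sum_j x j * y2 j) + k3 * (\sum_j x j * y3 j).
Proof.
by move=> zE; rewrite -sum3_scale; apply: eq_bigr => j _; rewrite zE; ring.
Qed.

(** These are the components of C = - sum al_j W_j (x) W_j, obtained by summing the eigenvector
    equations against the completeness relations. *)
Lemma spectral_moments (al p q r : 'I_3 -> C) :
  orthonormal_triple p q r ->
  (forall j, eigen_coords (al j) (p j) (q j) (r j)) ->
  [/\ \sum_j p j * (al j * p j) = - 2 * P0, \sum_j p j * (al j * q j) = - 2 * P1
    & \sum_j p j * (al j * r j) = - 2 * P2] /\
  [/\ \sum_j q j * (al j * q j) = - 2 * P2, \sum_j q j * (al j * r j) = - 2 * P3
    & \sum_j r j * (al j * r j) = - 2 * P4].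
Proof.
move=> h eig.
have [[pp0 pq0 pr0] [qq0 qr0 rr0]] := orthonormal_complete h.
have sC (u v : 'I_3 -> C) : \sum_j u j * v j = \sum_j v j * u j.
  by apply: eq_bigr => j _; rewrite mulrC.
have er j : al j * r j = P2 * r j + (- 2 * P3) * q j + P4 * p j.
  by case: (eig j) => _ _ <-; ring.
have eq' j : al j * q j = P1 * r j + (- 2 * P2) * q j + P3 * p j.
  by case: (eig j) => _ <- _; ring.
have ep j : al j * p j = P0 * r j + (- 2 * P1) * q j + P2 * p j.
  by case: (eig j) => <- _ _; ring.
have a_rr : \sum_j r j * (al j * r j) = - 2 * P4.
  by rewrite (sum3_lin _ er) rr0 (sC r q) qr0 (sC r p) pr0; ring.
have a_qr : \sum_j q j * (al j * r j) = - 2 * P3.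
  by rewrite (sum3_lin _ er) qr0 qq0 (sC q p) pq0; ring.
have a_pr : \sum_j p j * (al j * r j) = - 2 * P2.
  by rewrite (sum3_lin _ er) pr0 pq0 pp0; ring.
have a_qq : \sum_j q j * (al j * q j) = - 2 * P2.
  by rewrite (sum3_lin _ eq') qr0 qq0 (sC q p) pq0; ring.
have a_pq : \sum_j p j * (al j * q j) = - 2 * P1.
  by rewrite (sum3_lin _ eq') pr0 pq0 pp0; ring.
have a_pp : \sum_j p j * (al j * p j) = - 2 * P0.
  by rewrite (sum3_lin _ ep) pr0 pq0 pp0; ring.
by [].
Qed.

(* The coefficients are half the components UV, WV, VV of
   C^2 + x C + (x^2 - I), which annihilates the other two eigenvectors. *)
Lemma spectral_coefs (al p q r : 'I_3 -> C) (i : 'I_3) :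
  orthonormal_triple p q r ->
  (forall j, eigen_coords (al j) (p j) (q j) (r j)) ->
  (forall j k, j != k -> al j ^+ 2 + al j * al k + al k ^+ 2 = invI_of) ->
  [/\ coefA_of (al i) = coefD_of (al i) * (r i * p i),
      coefB_of (al i) = coefD_of (al i) * (r i * q i) &
      coefC_of (al i) = coefD_of (al i) * (r i * r i)].
Proof.
move=> h eig alI; have [[a_pp a_pq a_pr] [a_qq a_qr a_rr]] := spectral_moments h eig.
have [[_ _ pr0] [_ qr0 rr0]] := orthonormal_complete h.
have er j : al j * r j = P2 * r j + (- 2 * P3) * q j + P4 * p j.
  by case: (eig j) => _ _ <-; ring.
have sC (u v : 'I_3 -> C) : \sum_j u j * v j = \sum_j v j * u j.
  by apply: eq_bigr => j _; rewrite mulrC.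
have aC (u v : 'I_3 -> C) : \sum_j (al j * u j) * v j = \sum_j v j * (al j * u j).
  exact: sC.
have aS (u v : 'I_3 -> C) : \sum_j (al j * u j) * v j = \sum_j u j * (al j * v j).
  by apply: eq_bigr => j _; rewrite mulrCA mulrA.
have aa_rr : \sum_j (al j * r j) * (al j * r j) = 4 * P3 ^+ 2 - 4 * P2 * P4.
  by rewrite (sum3_lin _ er) !aC a_rr a_qr a_pr; ring.
have aa_qr : \sum_j (al j * q j) * (al j * r j) = 2 * P2 * P3 - 2 * P1 * P4.
  by rewrite (sum3_lin _ er) aS a_qr aC a_qq aC a_pq; ring.
have aa_pr : \sum_j (al j * p j) * (al j * r j) = 4 * P1 * P3 - 2 * P2 ^+ 2 - 2 * P0 * P4.
  by rewrite (sum3_lin _ er) aS a_pr aS a_pq aC a_pp; ring.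
have [n1 n2 n3] := ordS_neq i; rewrite eq_sym in n3.
have c1 := alI _ _ n1; have c2 := alI _ _ n3.
(* The polynomial x^2 + al_i x + al_i^2 - I vanishes at the two other eigenvalues and equals - 2 D_i
   at al_i. *)
have proj (u v : 'I_3 -> C) :
    coefD_of (al i) * (v i * u i) = - 2^-1 * (\sum_j (al j * u j) * (al j * v j)
      + al i * (\sum_j u j * (al j * v j))
      + (al i ^+ 2 - invI_of) * (\sum_j u j * v j)).
  rewrite !(sum_ord3 i) /coefD_of.
  by apply: (linear_comb2 (k1 := 2^-1 * u (ordS i) * v (ordS i))
    (k2 := 2^-1 * u (ordS (ordS i)) * v (ordS (ordS i))) c1 c2); field.
split; rewrite proj ?aa_pr ?aa_qr ?aa_rr ?a_pr ?a_qr ?a_rr ?pr0 ?qr0 ?rr0.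
- by rewrite /coefA_of; field.
- by rewrite /coefB_of; field.
- by rewrite /coefC_of; field.
Qed.

(** Cross product in complex 3-space: orthogonality to the factors is antisymmetry, the norm is
    Lagrange's identity, and the two remaining orientation relations are expansions of double cross
    products. *)
Lemma cross_orthonormal (p q r : 'I_3 -> C) (i : 'I_3) :
  let j := ordS i in let k := ordS (ordS i) in
  [/\ p i = 'i * (p j * q k - q j * p k),
      q i = 'i * (2^-1 * (p j * r k - r j * p k)) &
      r i = 'i * (q j * r k - r j * q k)] ->
  2^-1 * (p j * r j + r j * p j) - q j * q j = -1 ->
  2^-1 * (p k * r k + r k * p k) - q k * q k = -1 ->
  2^-1 * (p j * r k + r j * p k) - q j * q k = 0 ->
  orthonormal_triple p q r /\ oriented_coords p q r.
Proof.
move=> j k [pE qE rE] jj kk jk.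
have kj : 2^-1 * (p k * r j + r k * p j) - q k * q j = 0 by rewrite -[RHS]jk; ring.
have ij : 2^-1 * (p i * r j + r i * p j) - q i * q j = 0.
  by rewrite pE qE rE; field.
have ik : 2^-1 * (p i * r k + r i * p k) - q i * q k = 0.
  by rewrite pE qE rE; field.
have ji : 2^-1 * (p j * r i + r j * p i) - q j * q i = 0 by rewrite -[RHS]ij; ring.
have ki : 2^-1 * (p k * r i + r k * p i) - q k * q i = 0 by rewrite -[RHS]ik; ring.
have ii' : 2^-1 * (p i * r i + r i * p i) - q i * q i = -1.
  (* The Gram determinant of W_j and W_k. *)
  have e : (2^-1 * (p j * r j + r j * p j) - q j * q j)
    * (2^-1 * (p k * r k + r k * p k) - q k * q k)
    - (2^-1 * (p j * r k + r j * p k) - q j * q k) ^+ 2 = 1.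
    by rewrite jj kk jk; ring.
  rewrite pE qE rE; apply: (linear_comb2 (k1 := - 1)
   (k2 := 2^-1 * ((p j * q k - q j * p k) * (q j * r k - r j * q k)) *+ 2
     - (2^-1 * (p j * r k - r j * p k)) ^+ 2) e ii).
  by field.
(* Expanding the double product gives W_j times (W_k, W_k) and W_k times (W_j, W_k), hence the first
   two cofactors; the third accounts for the i^2 of two nested products. *)
have jE : [/\ p j = 'i * (p k * q i - q k * p i),
      q j = 'i * (2^-1 * (p k * r i - r k * p i)) &
      r j = 'i * (q k * r i - r k * q i)].
  rewrite pE qE rE; split.
  - by apply: (linear_comb3 (k1 := p j) (k2 := - p k) (k3 :=
      - (p k * (2^-1 * (p j * r k - r j * p k)) - q k * (p j * q k - q j * p k)))
      kk jk ii); field.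
  - by apply: (linear_comb3 (k1 := q j) (k2 := - q k) (k3 :=
      - (2^-1 * (p k * (q j * r k - r j * q k) - r k * (p j * q k - q j * p k))))
      kk jk ii); field.
  - by apply: (linear_comb3 (k1 := r j) (k2 := - r k) (k3 :=
      - (q k * (q j * r k - r j * q k) - r k * (2^-1 * (p j * r k - r j * p k))))
      kk jk ii); field.
have kE : [/\ p k = 'i * (p i * q j - q i * p j),
      q k = 'i * (2^-1 * (p i * r j - r i * p j)) &
      r k = 'i * (q i * r j - r i * q j)].
  rewrite pE qE rE; split.
  - by apply: (linear_comb3 (k1 := p k) (k2 := - p j) (k3 :=
      - ((p j * q k - q j * p k) * q j - 2^-1 * (p j * r k - r j * p k) * p j))
      jj jk ii); field.
  - by apply: (linear_comb3 (k1 := q k) (k2 := - q j) (k3 :=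
      - (2^-1 * ((p j * q k - q j * p k) * r j - (q j * r k - r j * q k) * p j)))
      jj jk ii); field.
  - by apply: (linear_comb3 (k1 := r k) (k2 := - r j) (k3 :=
      - (2^-1 * (p j * r k - r j * p k) * r j - (q j * r k - r j * q k) * q j))
      jj jk ii); field.
have [n1 n2 n3] := ordS_neq i.
split=> x; last by case: (ord3_cases i x) => ->; rewrite ?ordS3.
move=> y; case: (ord3_cases i x) => ->; case: (ord3_cases i y) => ->.
- by rewrite eqxx.
- by rewrite (negPf n1) oppr0.
- by rewrite eq_sym (negPf n3) oppr0.
- by rewrite eq_sym (negPf n1) oppr0.
- by rewrite eqxx.
- by rewrite (negPf n2) oppr0.
- by rewrite (negPf n3) oppr0.
- by rewrite eq_sym (negPf n2) oppr0.
- by rewrite eqxx.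
Qed.

(** The third clause is the divided difference of the characteristic cubic at two distinct roots. *)
Definition spectrum (al : 'I_3 -> C) : Prop :=
  [/\ injective al, \sum_i al i = 0,
      forall j k, j != k -> al j ^+ 2 + al j * al k + al k ^+ 2 = invI_of &
      forall j, al j ^+ 3 - invI_of * al j - 2 * invJ_of = 0].

(** A, B, C are the coordinates of (C^2 + x C + x^2 - I)(U). Applying C - x gives C^3 - I C - 2 J
    evaluated at U, zero by Cayley-Hamilton, as x is a root. *)
Lemma coefs_eigen (x : C) : x ^+ 3 - invI_of * x - 2 * invJ_of = 0 ->
  eigen_coords x (coefA_of x) (coefB_of x) (coefC_of x).
Proof.
rewrite /eigen_coords /coefA_of /coefB_of /coefC_of => h.
by split; [apply: (linear_comb1 (k := -1) h) | apply: (linear_comb1 (k := 0) h)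
  | apply: (linear_comb1 (k := 0) h)]; rewrite /invI_of /invJ_of; ring.
Qed.

(** Put P = C^2 + x C + x^2 - I with x a root. Then P^2 = - 2 D P and (U, P U) is half the
    coefficient C, so (P U, P U) = - D C. This is why sqrt(D_i C_i) normalizes W_i. *)
Lemma coefs_norm (x : C) : x ^+ 3 - invI_of * x - 2 * invJ_of = 0 ->
  coefA_of x * coefC_of x - coefB_of x * coefB_of x = - (coefD_of x * coefC_of x).
Proof.
rewrite /coefA_of /coefB_of /coefC_of /coefD_of => h.
by apply: (linear_comb1 (k := - 2^-1 * P4) h); rewrite /invI_of /invJ_of; field.
Qed.

Lemma eigen_orthogonal (x x' p q r p' q' r' : C) : x != x' ->
  eigen_coords x p q r -> eigen_coords x' p' q' r' ->
  2^-1 * (p * r' + r * p') - q * q' = 0.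
Proof.
rewrite -subr_eq0 => xx' [h1 h2 h3] [h1' h2' h3'].
apply: (mulfI xx'); rewrite mulr0.
have e1 : x * (2^-1 * (p * r' + r * p') - q * q') =
  2^-1 * ((P0 * r - 2 * P1 * q + P2 * p) * r' + (P2 * r - 2 * P3 * q + P4 * p) * p')
  - (P1 * r - 2 * P2 * q + P3 * p) * q' by rewrite h1 h2 h3; ring.
have e2 : x' * (2^-1 * (p * r' + r * p') - q * q') =
  2^-1 * (p * (P2 * r' - 2 * P3 * q' + P4 * p') + r * (P0 * r' - 2 * P1 * q' + P2 * p'))
  - q * (P1 * r' - 2 * P2 * q' + P3 * p') by rewrite h1' h2' h3'; ring.
by rewrite mulrBl e1 e2; field.
Qed.

Lemma eigen_scale (k x p q r : C) : eigen_coords x p q r ->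
  eigen_coords x (k * p) (k * q) (k * r).
Proof.
by case=> h1 h2 h3; split;
  [apply: (linear_comb1 (k := k) h1) | apply: (linear_comb1 (k := k) h2)
  | apply: (linear_comb1 (k := k) h3)]; ring.
Qed.

(* The Weyl operator is symmetric and trace-free. *)
Lemma third_eigen (al p q r : 'I_3 -> C) (i : 'I_3) :
  orthonormal_triple p q r -> \sum_j al j = 0 ->
  (forall j, j != i -> eigen_coords (al j) (p j) (q j) (r j)) ->
  eigen_coords (al i) (p i) (q i) (r i).
Proof.
move=> h s0 eig; have [n1 n2 n3] := ordS_neq i; rewrite eq_sym in n1.
have [[pp0 pq0 pr0] [qq0 qr0 rr0]] := orthonormal_complete h.
pose X := P0 * r i - 2 * P1 * q i + P2 * p i.
pose Y := P1 * r i - 2 * P2 * q i + P3 * p i.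
pose Z := P2 * r i - 2 * P3 * q i + P4 * p i.
have m0 j : j != i -> 2^-1 * (p j * Z + r j * X) - q j * Y = 0.
  move=> ji; have [h1 h2 h3] := eig j ji; have := h j i; rewrite (negPf ji) /= => hji.
  have -> : 2^-1 * (p j * Z + r j * X) - q j * Y =
    2^-1 * (r i * (P0 * r j - 2 * P1 * q j + P2 * p j)
      + p i * (P2 * r j - 2 * P3 * q j + P4 * p j))
    - q i * (P1 * r j - 2 * P2 * q j + P3 * p j) by rewrite /X /Y /Z; field.
  by rewrite h1 h2 h3; apply: (linear_comb1 (k := al j) hji); field.
have mi : 2^-1 * (p i * Z + r i * X) - q i * Y = - al i.
  have nm j : j != i -> 2^-1 * (p j * (P2 * r j - 2 * P3 * q j + P4 * p j)
      + r j * (P0 * r j - 2 * P1 * q j + P2 * p j))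
    - q j * (P1 * r j - 2 * P2 * q j + P3 * p j) = - al j.
    move=> ji; have [-> -> ->] := eig j ji; have := h j j; rewrite eqxx /= => hj.
    by apply: (linear_comb1 (k := al j) hj); field.
  have e1 := nm _ n1; have e2 := nm _ n3.
  move: pp0 pq0 pr0 qq0 qr0 rr0 s0; rewrite !(sum_ord3 i).
  move=> pp0 pq0 pr0 qq0 qr0 rr0 s0.
  apply: (linear_comb2 (k1 := -1) (k2 := -1) e1 e2).
  apply/eqP; rewrite -subr_eq0; apply/eqP.
  (* The sum of the three products (C(W_j), W_j) is written through the completeness sums; the two
     [P2] terms cancel because C is trace-free. *)
  transitivity (2^-1 * P4 * (p i * p i + p (ordS i) * p (ordS i) +
     p (ordS (ordS i)) * p (ordS (ordS i)))
   - (P1 + P1) * (q i * r i + q (ordS i) * r (ordS i) +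
        q (ordS (ordS i)) * r (ordS (ordS i)))
   - (P3 + P3) * (p i * q i + p (ordS i) * q (ordS i) +
        p (ordS (ordS i)) * q (ordS (ordS i)))
   + P2 * (p i * r i + p (ordS i) * r (ordS i) +
        p (ordS (ordS i)) * r (ordS (ordS i)))
   + 2 * P2 * (q i * q i + q (ordS i) * q (ordS i) +
        q (ordS (ordS i)) * q (ordS (ordS i)))
   + 2^-1 * P0 * (r i * r i + r (ordS i) * r (ordS i) +
     r (ordS (ordS i)) * r (ordS (ordS i)))
   + (al i + al (ordS i) + al (ordS (ordS i)))); first by rewrite /X /Y /Z; field.
  by rewrite pp0 qr0 pq0 pr0 qq0 rr0 s0; ring.
have m1 := m0 _ n1; have m2 := m0 _ n3.
have expand (u : 'I_3 -> C) : \sum_j u j * (2^-1 * (p j * Z + r j * X) - q j * Y)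
    = - al i * u i.
  by rewrite (sum_ord3 i) mi m1 m2; ring.
have dist (u : 'I_3 -> C) : \sum_j u j * (2^-1 * (p j * Z + r j * X) - q j * Y) =
    2^-1 * Z * (\sum_j u j * p j) + 2^-1 * X * (\sum_j u j * r j)
    - Y * (\sum_j u j * q j).
  by rewrite !(sum_ord3 i); ring.
have sC (u v : 'I_3 -> C) : \sum_j u j * v j = \sum_j v j * u j.
  by apply: eq_bigr => j _; rewrite mulrC.
have ep := expand p; have eq' := expand q; have er := expand r.
rewrite dist in ep; rewrite dist in eq'; rewrite dist in er.
rewrite pp0 pr0 pq0 in ep; rewrite (sC q p) pq0 qr0 qq0 in eq'.
rewrite (sC r p) pr0 rr0 (sC r q) qr0 in er.
by split; [apply: (linear_comb1 (k := -1) ep) | apply: (linear_comb1 (k := -1) eq')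
  | apply: (linear_comb1 (k := -1) er)]; rewrite -/X -/Y -/Z; field.
Qed.

(** - 2 D_i is the derivative of the cubic at the simple root al_i, the product of its differences
    to the other roots. *)
Lemma coefD_neq0 (al : 'I_3 -> C) (i : 'I_3) : spectrum al -> coefD_of (al i) != 0.
Proof.
move=> [inj_al s0 alI _]; have [n1 n2 n3] := ordS_neq i.
rewrite /coefD_of -(alI _ _ n1).
have -> : al i ^+ 2 + al i * al (ordS i) + al (ordS i) ^+ 2 - 3 * al i ^+ 2
    = (al (ordS i) - al i) * (al i - al (ordS (ordS i))).
  move: s0; rewrite (sum_ord3 i) => s0.
  by apply: (linear_comb1 (k := al (ordS i) - al i) s0); ring.
rewrite !mulf_eq0 invr_eq0 pnatr_eq0 /= !subr_eq0 !(inj_eq inj_al).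
by rewrite negb_or eq_sym n1 eq_sym n3.
Qed.

(** Two vanishing C_i force Psi_4 = Psi_3 = 0, a repeated principal null direction, and then the
    cubic has a double root. *)
Lemma coefC_two (al : 'I_3 -> C) (i j : 'I_3) : spectrum al ->
  coefC_of (al i) = 0 -> coefC_of (al j) = 0 -> i = j.
Proof.
move=> sp Ci Cj; have [inj_al s0 alI cub] := sp; apply/eqP/negP => /negP ij.
have : P4 * (al i - al j) = 0.
  by apply: (linear_comb2 (k1 := 1) (k2 := -1) Ci Cj); rewrite /coefC_of; ring.
move/eqP; rewrite mulf_eq0 subr_eq0 (inj_eq inj_al) (negPf ij) orbF => /eqP p4.
have p3 : P3 = 0.
  apply/eqP; rewrite -sqrf_eq0; apply/eqP.
  by apply: (linear_comb2 (k1 := - 2^-1) (k2 := P2 + 2^-1 * al i) Ci p4); rewrite /coefC_of; field.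
(* The cubic is now (x + 2 Psi_2) (x - Psi_2)^2, and D is zero at the root Psi_2; so every
   eigenvalue would be - 2 Psi_2. *)
have al2 k : al k = - 2 * P2.
  have /eqP := cub k; have := coefD_neq0 k sp.
  rewrite /coefD_of /invI_of /invJ_of p3 p4 => Dk.
  have -> : al k ^+ 3 - (P0 * 0 - 4 * P1 * 0 + 3 * P2 ^+ 2) * al k - 2 *
      (P0 * P2 * 0 + 2 * P1 * P2 * 0 - P2 ^+ 3 - P0 * 0 ^+ 2 - P1 ^+ 2 * 0) =
      (al k + 2 * P2) * (al k - P2) ^+ 2 by ring.
  rewrite mulf_eq0 sqrf_eq0 => /orP[/eqP h|/eqP h].
    by apply: (linear_comb1 (k := 1) h); ring.
  case/eqP: Dk; apply: (linear_comb1 (k := - 3 * 2^-1 * (al k + P2)) h).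
  by field.
by case/eqP: ij; apply: inj_al; rewrite !al2.
Qed.

Lemma spectral_triple (al p q r : 'I_3 -> C) (i : 'I_3) : spectrum al ->
  (forall j, j != i -> coefC_of (al j) != 0 /\
     exists2 d, d ^+ 2 = coefD_of (al j) * coefC_of (al j) &
     [/\ p j = d^-1 * coefA_of (al j), q j = d^-1 * coefB_of (al j)
       & r j = d^-1 * coefC_of (al j)]) ->
  let j := ordS i in let k := ordS (ordS i) in
  [/\ p i = 'i * (p j * q k - q j * p k),
      q i = 'i * (2^-1 * (p j * r k - r j * p k)) &
      r i = 'i * (q j * r k - r j * q k)] ->
  [/\ orthonormal_triple p q r, oriented_coords p q r &
      forall j, eigen_coords (al j) (p j) (q j) (r j)].
Proof.
move=> sp hform /= iE; have [n1 n2 n3] := ordS_neq i; rewrite eq_sym in n1.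
have [inj_al s0 _ cub] := sp.
have eig j : j != i -> eigen_coords (al j) (p j) (q j) (r j).
  move=> ji; have [_ [d _ [-> -> ->]]] := hform j ji.
  by apply: eigen_scale; apply: coefs_eigen.
have norm j : j != i -> 2^-1 * (p j * r j + r j * p j) - q j * q j = -1.
  move=> ji; have [C0 [d dE [-> -> ->]]] := hform j ji.
  have d0 : d != 0 by rewrite -sqrf_eq0 dE mulf_neq0 ?coefD_neq0.
  apply: (mulfI (expf_neq0 2 d0)); rewrite mulrN1 {2}dE -(coefs_norm (cub j)).
  by field.
have jk : 2^-1 * (p (ordS i) * r (ordS (ordS i)) + r (ordS i) * p (ordS (ordS i)))
    - q (ordS i) * q (ordS (ordS i)) = 0.
  by apply: (eigen_orthogonal _ (eig _ n1) (eig _ n3)); rewrite (inj_eq inj_al).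
have [h o] := cross_orthonormal iE (norm _ n1) (norm _ n3) jk.
split=> // j; case: (eqVneq j i) => [->|]; last exact: eig.
exact: third_eigen h s0 eig.
Qed.

End Spectral.

(** * The closed formula for the principal forms and their orientation *)

Section PrincipalForms.
Variables (C : numClosedFieldType) (G : lorentz_data C) (T : lorentz_frame G).
Variable Psi : 'I_5 -> C.
Local Notation s := ((sqrtC 2)^-1 : C).
Local Notation F := (tform T).
Local Notation coefA := (coefA_of (Psi 0) (Psi 1) (Psi 2) (Psi 3) (Psi 4)).
Local Notation coefB := (coefB_of (Psi 1) (Psi 2) (Psi 3) (Psi 4)).
Local Notation coefC := (coefC_of (Psi 2) (Psi 3) (Psi 4)).
Local Notation coefD := (coefD_of (Psi 0) (Psi 1) (Psi 2) (Psi 3) (Psi 4)).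
Local Notation eigen := (eigen_coords (Psi 0) (Psi 1) (Psi 2) (Psi 3) (Psi 4)).
Local Notation spectral := (spectrum (Psi 0) (Psi 1) (Psi 2) (Psi 3) (Psi 4)).

Let ii : 'i * 'i = -1 :> C. Proof. by rewrite -expr2 sqrCi. Qed.
Let s0 : s != 0. Proof. by rewrite invr_neq0 // sqrtC2_neq0. Qed.

Definition pformula (al : 'I_3 -> C) (W : 'I_3 -> 'M[C]_4) : Prop :=
  forall i, coefC (al i) != 0 ->
    exists2 d, d ^+ 2 = coefD (al i) * coefC (al i) &
      W i = d^-1 *: F (coefA (al i)) (coefB (al i)) (coefC (al i)).

Definition poriented (W : 'I_3 -> 'M[C]_4) : Prop :=
  W 2 = ('i * sqrtC 2) *: pmul G (W 0) (W 1).

Definition principal_coords (al p q r : 'I_3 -> C) : Prop :=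
  [/\ orthonormal_triple p q r, oriented_coords p q r &
      forall j, eigen (al j) (p j) (q j) (r j)].

Lemma pauli_oriented W i : pauli_triple G W ->
  W (ordS (ordS i)) = ('i * sqrtC 2) *: pmul G (W i) (W (ordS i)).
Proof.
move=> pW; rewrite (pauli_mul pW) scalerA -[LHS]scale1r; congr (_ *: _).
have := ii; have : s * sqrtC 2 = 1 by rewrite mulVf ?sqrtC2_neq0.
move: (sqrtC 2) s => u t tu i2.
by apply: (linear_comb2 (k1 := 'i * 'i) (k2 := 1) tu i2); ring.
Qed.

Lemma spectral_choice al : spectral al ->
  exists i, forall j, j != i -> coefC (al j) != 0.
Proof.
move=> sp; have [|i /andP[h1 h2]] := @ord3_choice (fun j => coefC (al j) != 0).
  by move=> i j /negPn/eqP hi /negPn/eqP hj; apply: coefC_two sp hi hj.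
by exists i => j; case: (ord3_cases i j) => -> //; rewrite eqxx.
Qed.

Lemma coords_formula al p q r : spectral al -> principal_coords al p q r ->
  pformula al (fun i => F (p i) (q i) (r i)).
Proof.
move=> sp [h o eig] i Ci.
have [_ _ alI _] := sp; have [eA eB eC] := spectral_coefs i h eig alI.
(* Since C_i = D_i r_i^2, the number D_i r_i is a square root of D_i C_i. *)
exists (coefD (al i) * r i); first by rewrite eC; ring.
have D0 := coefD_neq0 i sp.
have r0 : r i != 0 by apply: contraNneq Ci => r0; rewrite eC r0 !mulr0.
rewrite tformZ eA eB eC; congr (tform _ _ _ _); field; exact/andP.
Qed.

Lemma principal_exists al : spectral al ->
  exists p q r, principal_coords al p q r.
Proof.
move=> sp; have [i hi] := spectral_choice sp; have [n1 n2 n3] := ordS_neq i.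
pose d j := sqrtC (coefD (al j) * coefC (al j)).
pose x (cA : C -> C) j := (d j)^-1 * cA (al j).
pose j := ordS i; pose k := ordS (ordS i).
pose p l := if l == i then 'i * (x coefA j * x coefB k - x coefB j * x coefA k)
            else x coefA l.
pose q l := if l == i then 'i * (2^-1 * (x coefA j * x coefC k - x coefC j * x coefA k))
            else x coefB l.
pose r l := if l == i then 'i * (x coefB j * x coefC k - x coefC j * x coefB k)
            else x coefC l.
exists p, q, r; apply: (spectral_triple (i := i) sp).
  move=> l li; split; first exact: hi.
  exists (d l); first by rewrite sqrtCK.
  by rewrite /p /q /r (negPf li).
by rewrite /= /p /q /r eqxx eq_sym (negPf n1) (negPf n3).
Qed.

Lemma pauli_ext W W' : W =1 W' -> pauli_triple G W' -> pauli_triple G W.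
Proof.
move=> e pW; split=> i; rewrite !e; first exact: pauli_sd.
- exact: pauli_sqr.
- exact: pauli_mul.
- exact: pauli_mulr.
Qed.

(** The orientation condition gives W_3 outright. For the first form it is multiplied by the second
    on the right, for the second by the first on the left, and a square 1/2 g cancels. *)
Lemma poriented_third W W' i : pauli_triple G W' -> poriented W ->
  (forall j, j != i -> W j = W' j) -> W i = W' i.
Proof.
move=> pW oW e.
have e1 : ordS 0 = 1 :> 'I_3 by exact/val_inj.
have e2 : ordS 1 = 2 :> 'I_3 by exact/val_inj.
have e3 : ordS 2 = 0 :> 'I_3 by exact/val_inj.
have half (X Y : 'M[C]_4) : ('i * s) *: X = ('i * sqrtC 2) *: (2^-1 *: Y) -> X = Y.
  rewrite scalerA; have -> : 'i * sqrtC 2 * 2^-1 = 'i * s.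
    by rewrite -mulrA sqrtC2_mul; congr (_ * _); move: s => t; field.
  have nz : 'i * s != 0 by apply: mulf_neq0 s0; apply: neq0Ci.
  by move=> h; apply: (scalerI nz).
case: (ord3_cases 2 i) => iE; rewrite ?e3 ?e1 in iE; rewrite iE; move: e; rewrite iE => e.
- have n0 : 0 != 2 :> 'I_3 by []. have n1 : 1 != 2 :> 'I_3 by [].
  by rewrite oW !e // -{1}e1 -pauli_oriented // e1 e2.
- have n2 : 2 != 0 :> 'I_3 by []. have n1 : 1 != 0 :> 'I_3 by [].
  symmetry; apply: half; have := pauli_mulr pW 1; rewrite e2 e3 => <-.
  rewrite -!e // oW pmulZl -pmulA (e 1) // (pauli_sqr pW) pmulZr.
  by rewrite pmul_metric.
- have n2 : 2 != 1 :> 'I_3 by []. have n0 : 0 != 1 :> 'I_3 by [].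
  symmetry; apply: half; have := pauli_mulr pW 2; rewrite e3 e1 => <-.
  rewrite -!e // oW pmulZr pmulA (e 0) // (pauli_sqr pW) pmulZl.
  by rewrite /pmul mulmxV ?gmx_unit // mul1mx.
Qed.

(** Two forms come from the formula with whatever roots were chosen. Their signs fix the third
    through the orientation, so its coordinates are defined by the oriented product. *)
Lemma formula_coords al W : spectral al -> pformula al W -> poriented W ->
  exists p q r, principal_coords al p q r /\ forall i, W i = F (p i) (q i) (r i).
Proof.
move=> sp fW oW; have [i hi] := spectral_choice sp; have [n1 n2 n3] := ordS_neq i.
pose j := ordS i; pose k := ordS (ordS i).
have ji : j != i by rewrite eq_sym.
have [d1 d1E W1] := fW j (hi _ ji); have [d2 d2E W2] := fW k (hi _ n3).
pose d l := if l == j then d1 else d2.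
pose x (cA : C -> C) l := (d l)^-1 * cA (al l).
pose p l := if l == i then 'i * (x coefA j * x coefB k - x coefB j * x coefA k)
            else x coefA l.
pose q l := if l == i then 'i * (2^-1 * (x coefA j * x coefC k - x coefC j * x coefA k))
            else x coefB l.
pose r l := if l == i then 'i * (x coefB j * x coefC k - x coefC j * x coefB k)
            else x coefC l.
have dk : d k = d2 by rewrite /d eq_sym (negPf n2).
have dj : d j = d1 by rewrite /d eqxx.
have coords : principal_coords al p q r.
  apply: (spectral_triple (i := i) sp).
    move=> l li; split; first exact: hi.
    exists (d l); last by rewrite /p /q /r (negPf li).
    case: (ord3_cases i l) li => ->; rewrite ?eqxx // => _.
      by rewrite -/j dj.
    by rewrite -/k dk.
  by rewrite /= /p /q /r eqxx -/j -/k (negPf ji) (negPf n3).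
exists p, q, r; split=> // l.
have pW : pauli_triple G (fun i => F (p i) (q i) (r i)).
  by case: coords => h o _; apply: coords_pauli.
have Wl m : m != i -> W m = F (p m) (q m) (r m).
  case: (ord3_cases i m) => ->; rewrite ?eqxx // => _.
    by rewrite -/j W1 tformZ /p /q /r (negPf ji) /x dj.
  by rewrite -/k W2 tformZ /p /q /r (negPf n3) /x dk.
case: (eqVneq l i) => [->|]; last exact: Wl.
exact: (poriented_third pW oW Wl).
Qed.

End PrincipalForms.

(** * The Weyl operator in null-frame coordinates *)

Section WeylOperator.
Variables (C : numClosedFieldType) (G : lorentz_data C).
Variable L : 'M[C]_4 -> 'M[C]_4.

Definition component_sum (Psi : 'I_5 -> C) (u w v : C) (U W V : 'M[C]_4) :
    'M[C]_4 :=
  Psi 0 *: (u *: U) + Psi 1 *: (w *: U + u *: W)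
  + Psi 2 *: (v *: U + u *: V + w *: W)
  + Psi 3 *: (v *: W + w *: V) + Psi 4 *: (v *: V).

Definition pcomponents (l k m : 'cV[C]_4) (Psi : 'I_5 -> C) : Prop :=
  let W := formW G l k m in let U := formU G l m in let V := formV G k m in
  forall X, 2^-1 *: L X =
    component_sum Psi (pip G U X) (pip G W X) (pip G V X) U W V.

Section InFrame.
Variables (T : lorentz_frame G) (Psi : 'I_5 -> C).
Hypothesis compT : pcomponents (fl T) (fk T) (fm T) Psi.
Local Notation F := (tform T).
Local Notation eigen := (eigen_coords (Psi 0) (Psi 1) (Psi 2) (Psi 3) (Psi 4)).

Definition pu X := pip G (F 1 0 0) X.
Definition pw X := pip G (F 0 1 0) X.
Definition pv X := pip G (F 0 0 1) X.

Lemma pip_tform p q r X : pip G (F p q r) X = p * pu X + q * pw X + r * pv X.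
Proof.
rewrite -!pipZl -!pipDl !tformZ !tformD; congr (pip _ (tform _ _ _ _) _); ring.
Qed.

Lemma weylE X : L X = F (2 * (Psi 0 * pu X + Psi 1 * pw X + Psi 2 * pv X))
  (2 * (Psi 1 * pu X + Psi 2 * pw X + Psi 3 * pv X))
  (2 * (Psi 2 * pu X + Psi 3 * pw X + Psi 4 * pv X)).
Proof.
have := compT X; rewrite /component_sum (tform_U T) (tform_W T) (tform_V T) -/(pu X) -/(pw X) -/(pv X).
rewrite !(tformZ, tformD) => /(congr1 ( *:%R 2)).
rewrite scalerA mulfV ?pnatr_eq0 // scale1r => ->.
by rewrite tformZ; congr (tform _ _ _ _); ring.
Qed.

Lemma weyl_tform p q r : L (F p q r) = F (Psi 0 * r - 2 * Psi 1 * q + Psi 2 * p)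
  (Psi 1 * r - 2 * Psi 2 * q + Psi 3 * p) (Psi 2 * r - 2 * Psi 3 * q + Psi 4 * p).
Proof.
by rewrite weylE /pu /pw /pv !tform_ip; congr (tform _ _ _ _); field.
Qed.

Lemma weyl_eigen x p q r : L (F p q r) = x *: F p q r <-> eigen x p q r.
Proof.
rewrite weyl_tform tformZ; split=> [/tform_inj|] [e1 e2 e3] //.
by rewrite e1 e2 e3.
Qed.

Lemma weyl_spectral al p q r X : principal_coords Psi al p q r ->
  L X = - \sum_i (al i * pip G (F (p i) (q i) (r i)) X) *: F (p i) (q i) (r i).
Proof.
move=> [h _ eig]; have [[pp pq pr] [qq qr rr]] := spectral_moments h eig.
rewrite weylE -scaleN1r (sum_ord3 0) !(tformZ, tformD) !pip_tform.
move: pp pq pr qq qr rr; rewrite !(sum_ord3 0) => pp pq pr qq qr rr.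
congr (tform _ _ _ _).
- by apply: (linear_comb3 (k1 := pu X) (k2 := pw X) (k3 := pv X) pp pq pr); ring.
- by apply: (linear_comb3 (k1 := pu X) (k2 := pw X) (k3 := pv X) pq qq qr); ring.
- by apply: (linear_comb3 (k1 := pu X) (k2 := pw X) (k3 := pv X) pr qr rr); ring.
Qed.

End InFrame.
End WeylOperator.

Section CanonicalCoefs.
Variable C : numClosedFieldType.
Variable Psi : 'I_5 -> C.
Local Notation coefB := (coefB_of (Psi 1) (Psi 2) (Psi 3) (Psi 4)).
Local Notation coefC := (coefC_of (Psi 2) (Psi 3) (Psi 4)).
Local Notation coefD := (coefD_of (Psi 0) (Psi 1) (Psi 2) (Psi 3) (Psi 4)).
Local Notation spectral := (spectrum (Psi 0) (Psi 1) (Psi 2) (Psi 3) (Psi 4)).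

(** From C_i = D_i r_i^2 the quotient is |r_i|^2, so the choice of square roots drops out. *)
Lemma coefb_rr al p q r : spectral al -> principal_coords Psi al p q r ->
  \sum_(i < 3) `|coefC (al i)| / `|coefD (al i)| = rr r.
Proof.
move=> sp [h o eig]; have [_ _ alI _] := sp; apply: eq_bigr => i _.
have [_ _ ->] := spectral_coefs i h eig alI.
have := coefD_neq0 i sp; rewrite -normr_eq0; move: (coefD (al i)) => D D0.
by rewrite !normrM [LHS]mulrC (mulKf D0) -expr2 normCK.
Qed.

Lemma coefc_qr al p q r : spectral al -> principal_coords Psi al p q r ->
  - \sum_(i < 3) (coefB (al i))^* * coefC (al i)
      / (`|coefD (al i)| * `|coefC (al i)|) = qr q r.
Proof.
move=> sp [h o eig]; have [_ _ alI _] := sp; congr (- _); apply: eq_bigr => i _.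
have [_ -> ->] := spectral_coefs i h eig alI.
have D0 := coefD_neq0 i sp; move: (coefD (al i)) D0 => D D0.
(* Here B_i and C_i vanish and the quotient is 0 by convention. *)
have [->|r0] := eqVneq (r i) 0; first by rewrite !mul0r !mulr0 !mul0r.
rewrite !rmorphM !normrM.
have -> : `|D| * (`|D| * (`|r i| * `|r i|)) = D * D^* * (r i * (r i)^*).
  by rewrite -!normCK; ring.
field; rewrite D0 r0 !conjC_eq0 D0 r0; exact/andP.
Qed.

End CanonicalCoefs.

(** * Principal transverse frames and their eigenforms *)

Section TransverseFrames.
Variables (C : numClosedFieldType) (G : lorentz_data C).
Variable L : 'M[C]_4 -> 'M[C]_4.
Local Notation s := ((sqrtC 2)^-1 : C).

Let ii : 'i * 'i = -1 :> C. Proof. by rewrite -expr2 sqrCi. Qed.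
Let ss : s * s = 2^-1. Proof. exact: sqrtC2_inv_sqr. Qed.

Definition transverse_psi (x y : C) : 'I_5 -> C := fun a => tnth [tuple x; 0; y; 0; x] a.

(** For the base of this tetrad U (x) U + V (x) V = (W_j (x) W_j - W_k (x) W_k) / 2, and the
    symmetrized product of U and V is - (W_j (x) W_j + W_k (x) W_k) / 2. Matching with - sum al_j
    W_j (x) W_j, with al of sum zero, gives the components. *)
Lemma pauli_components W e0 e al i : pauli_triple G W ->
  (forall j, e j = sqrtC 2 *: papp G (W j) e0) -> cjmx e0 = e0 ->
  pdot G e0 e0 = -1 -> (forall j, cjmx (e j) = e j) ->
  (forall X, L X = - \sum_j (al j * pip G (W j) X) *: W j) ->
  \sum_j al j = 0 ->
  pcomponents G L (pauli_l e0 e i) (pauli_k e0 e i) (pauli_m e i)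
   (transverse_psi (2^-1 * (al (ordS (ordS i)) - al (ordS i))) (- 2^-1 * al i)).
Proof.
move=> pW eE e0R e01 eR LE sal; rewrite /pcomponents /component_sum; cbv zeta; move=> X.
rewrite (pauli_formW pW eE e0R e01 eR) (pauli_formU pW eE e0R e01 eR).
rewrite (pauli_formV pW eE e0R e01 eR) LE /transverse_psi /tnth /=.
rewrite -!scaleN1r !(pipZl, pipDl) (sum_ord3 i); move: sal; rewrite (sum_ord3 i).
move: (pip G (W i) X) (pip G (W (ordS i)) X) (pip G (W (ordS (ordS i))) X) => x y z.
move: (W i) (W (ordS i)) (W (ordS (ordS i))) => A B D.
move: (al i) (al (ordS i)) (al (ordS (ordS i))) => a b d sal.
apply/matrixP => k l; rewrite !mxE.
by apply: (linear_comb2 (k1 := - 4^-1 * (y * B k l + z * D k l))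
  (k2 := - 2^-1 * z * D k l * (2^-1 * (d - b) + - 2^-1 * a)) sal ii); field.
Qed.

Variables (T T' : lorentz_frame G) (Psi Psi' : 'I_5 -> C).
Hypothesis compT : pcomponents G L (fl T) (fk T) (fm T) Psi.
Hypothesis compT' : pcomponents G L (fl T') (fk T') (fm T') Psi'.
Hypothesis transv : [/\ Psi' 1 = 0, Psi' 3 = 0 & Psi' 0 = Psi' 4].
Local Notation F := (tform T).
Local Notation F' := (tform T').

(** The triple inverts [pauli_formW], [pauli_formU] and [pauli_formV] at index 0; with these signs
    it is oriented and its tetrad at index 0 is the given one. *)
Definition transverse_al : 'I_3 -> C :=
  fun j => tnth [tuple - 2 * Psi' 2; Psi' 2 - Psi' 0; Psi' 2 + Psi' 0] j.
Definition transverse_p : 'I_3 -> C := fun j => tnth [tuple 0; -1; - 'i] j.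
Definition transverse_q : 'I_3 -> C := fun j => tnth [tuple -1; 0; 0] j.
Definition transverse_r : 'I_3 -> C := fun j => tnth [tuple 0; 1; - 'i] j.

Lemma transverse_principal :
  principal_coords Psi' transverse_al transverse_p transverse_q transverse_r.
Proof.
have [P1 P3 P0] := transv.
have [h o] : orthonormal_triple transverse_p transverse_q transverse_r /\
    oriented_coords transverse_p transverse_q transverse_r.
  apply: (@cross_orthonormal _ _ _ _ 0) => /=; rewrite /transverse_p /transverse_q /transverse_r /tnth /=.
  - by split; [ring | apply: (linear_comb1 (k := -1) ii); field | ring].
  - by field.
  - by apply: (linear_comb1 (k := 1) ii); field.
  - by field.
split=> // j; rewrite /eigen_coords P1 P3 -P0.
rewrite /transverse_al /transverse_p /transverse_q /transverse_r.
by case: j => [[|[|[|j]]] Hj] //; rewrite /tnth /=; split; ring.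
Qed.

Lemma transverse_vieta :
  let I := invI_of (Psi' 0) (Psi' 1) (Psi' 2) (Psi' 3) (Psi' 4) in
  let J := invJ_of (Psi' 0) (Psi' 1) (Psi' 2) (Psi' 3) (Psi' 4) in
  [/\ transverse_al 0 + transverse_al 1 + transverse_al 2 = 0,
      transverse_al 0 * transverse_al 1 + transverse_al 1 * transverse_al 2
        + transverse_al 2 * transverse_al 0 = - I &
      transverse_al 0 * transverse_al 1 * transverse_al 2 = 2 * J].
Proof.
have [P1 P3 P0] := transv.
rewrite /transverse_al /tnth /= /invI_of /invJ_of P1 P3 -P0.
by split; ring.
Qed.

(* Nonzero eigenvalues put W_j in the range of L; at most one eigenvalue
   vanishes, and its eigenform is the product of the other two. *)
Lemma spanned_coords (W : 'I_3 -> 'M[C]_4) (al : 'I_3 -> C) :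
  pauli_triple G W -> injective al -> (forall j, L (W j) = al j *: W j) ->
  (forall j k, j != k -> pip G (W j) (W k) = 0) ->
  forall j, exists x, W j = F x.1.1 x.1.2 x.2.
Proof.
move=> pW inj_al eig orthW.
have span j : al j != 0 -> exists x, W j = F x.1.1 x.1.2 x.2.
  move=> aj; have -> : W j = (al j)^-1 *: L (W j).
    by rewrite eig scalerA mulVf // scale1r.
  rewrite (weylE compT) tformZ; set x := _ * _; set y := _ * _; set z := _ * _.
  by exists (x, y, z).
have [|i /andP[aj ak]] := @ord3_choice (fun j => al j != 0).
  by move=> a b /negPn/eqP ea /negPn/eqP eb; apply: inj_al; rewrite ea eb.
have [n1 n2 n3] := ordS_neq i.
have [[[p q] r] /= ej] := span _ aj; have [[[p' q'] r'] /= ek] := span _ ak.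
move=> j; case: (ord3_cases i j) => ->; first last.
- by exists (p', q', r').
- by exists (p, q, r).
have := pauli_oriented (ordS i) pW; rewrite ordS3 => ->.
have := orthW _ _ n2; rewrite ej ek tform_ip => o.
rewrite tform_mul; have -> : 2^-1 * (q * q' - 2^-1 * (p * r' + r * p')) = 0.
  by apply: (linear_comb1 (k := - 2^-1) o); field.
rewrite scale0r add0r !tformZ; set x := _ * _; set y := _ * _; set z := _ * _.
by exists (x, y, z).
Qed.

(** The eigenforms are known in the frame [T'], whereas the formula to be matched lives in [T]. The
    passage goes through the range of the Weyl operator, which lies in the span of either bivector
    base. *)
Lemma transverse_coords : injective transverse_al ->
  exists p q r, principal_coords Psi transverse_al p q r /\
    forall j, F (p j) (q j) (r j) =
      F' (transverse_p j) (transverse_q j) (transverse_r j).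
Proof.
move=> inj_al; have [h o eig] := transverse_principal.
pose W j := F' (transverse_p j) (transverse_q j) (transverse_r j).
have pW : pauli_triple G W by apply: coords_pauli.
have ipW j k : pip G (W j) (W k) = - (j == k)%:R by rewrite tform_ip h.
have LW j : L (W j) = transverse_al j *: W j by apply/(weyl_eigen compT').
have orthW j k : j != k -> pip G (W j) (W k) = 0.
  by move=> jk; rewrite ipW (negPf jk) oppr0.
have [x xE] := fin_all_exists (spanned_coords pW inj_al LW orthW).
exists (fun j => (x j).1.1), (fun j => (x j).1.2), (fun j => (x j).2).
split; last by move=> j; rewrite -xE.
have h' : orthonormal_triple (fun j => (x j).1.1) (fun j => (x j).1.2) (fun j => (x j).2).
  by move=> j k; rewrite -(tform_ip T) -!xE ipW.
split=> //.
- move=> j; have := pauli_oriented j pW; rewrite !xE tform_mul.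
  have [n1 _ _] := ordS_neq j; have := h' j (ordS j); rewrite (negPf n1) /= => o1.
  have -> : 2^-1 * ((x j).1.2 * (x (ordS j)).1.2 - 2^-1 * ((x j).1.1 * (x (ordS j)).2
      + (x j).2 * (x (ordS j)).1.1)) = 0.
    by apply: (linear_comb1 (k := - 2^-1) o1); field.
  rewrite scale0r add0r !tformZ => /tform_inj.
  have cancel y : 'i * sqrtC 2 * (s * y) = 'i * y.
    by rewrite !mulrA -(mulrA 'i) mulfV ?sqrtC2_neq0 // mulr1.
  by rewrite !cancel.
- by move=> j; apply/(weyl_eigen compT); rewrite -xE.
Qed.

(** W_1(e_0) reverses the m-coordinates relative to conjugation, so its reality and that of e_0 make
    them vanish; reality of W_2(e_0) equates the l- and k-coordinates, and the norm leaves two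
    signs. *)
Lemma transverse_canonical e0 :
  let W j := F' (transverse_p j) (transverse_q j) (transverse_r j) in
  let e j := sqrtC 2 *: papp G (W j) e0 in
  cjmx e0 = e0 -> pdot G e0 e0 = -1 -> (forall j, cjmx (e j) = e j) ->
  [/\ pauli_l e0 e 0 = fl T', pauli_k e0 e 0 = fk T' & pauli_m e 0 = fm T'] \/
  e0 = - (s *: (fl T' + fk T')).
Proof.
move=> W e e0R e01 eR; have [x [y [z [w e0E]]]] := tvec_span T' e0.
have cs k : (sqrtC 2 * s) * k = k by rewrite mulfV ?mul1r ?sqrtC2_neq0.
have appE j : e j = tvec T' (- transverse_q j * x - transverse_p j * z)
    (transverse_q j * y + transverse_r j * w) (transverse_q j * z + transverse_r j * x)
    (- transverse_q j * w - transverse_p j * y).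
  by rewrite /e /W e0E app_tform_tvec scalerA tvecZ !cs.
have := eR 0; rewrite !appE tvec_conj /transverse_p /transverse_q /transverse_r /tnth /=.
case/tvec_inj => _ _ h1 _.
have := eR 1; rewrite !appE tvec_conj /transverse_p /transverse_q /transverse_r /tnth /=.
case/tvec_inj => _ _ h2 _.
have := e0R; rewrite {1 2}e0E tvec_conj => /tvec_inj [xR yR wz zw].
have z0 : z = 0.
  move: h1; rewrite !(rmorphB, rmorphM, rmorphN, rmorph0, rmorph1) /= wz => h1.
  by apply: (linear_comb1 (k := 2^-1) h1); field.
have w0 : w = 0 by rewrite -zw z0 rmorph0.
have yx : y = x.
  move: h2; rewrite !(rmorphB, rmorphM, rmorphN, rmorph0, rmorph1) /= yR => h2.
  by apply: (linear_comb1 (k := 1) h2); ring.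
have := e01; rewrite {1 2}e0E z0 w0 yx tvec_dot => xx.
have : (x - s) * (x + s) = 0.
  move: s ss => t tt.
  by apply: (linear_comb2 (k1 := - 2^-1) (k2 := -1) xx tt); field.
move/eqP; rewrite mulf_eq0 subr_eq0 addr_eq0 => /orP[] /eqP xs; last first.
  right; rewrite e0E z0 w0 yx xs tvecE !scale0r !addr0 scalerDr !scaleNr.
  by rewrite -opprD.
left; have e0E' : e0 = tvec T' s s 0 0 by rewrite e0E z0 w0 yx xs.
have tE : [/\ fl T' = tvec T' 1 0 0 0, fk T' = tvec T' 0 1 0 0 & fm T' = tvec T' 0 0 1 0].
  by split; [exact: tvec_l | exact: tvec_k | exact: tvec_m].
case: tE => -> -> ->; split.
- rewrite /pauli_l appE e0E' z0 w0 yx xs /transverse_p /transverse_q /transverse_r /tnth /=.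
  rewrite tvecD tvecZ; move: s ss => t tt; congr (tvec _ _ _ _ _); try ring.
  by apply: (linear_comb1 (k := 2) tt); field.
- rewrite /pauli_k appE e0E' z0 w0 yx xs /transverse_p /transverse_q /transverse_r /tnth /=.
  rewrite tvecN tvecD tvecZ; move: s ss => t tt; congr (tvec _ _ _ _ _); try ring.
  by apply: (linear_comb1 (k := 2) tt); field.
- rewrite /pauli_m !appE z0 w0 yx xs /transverse_p /transverse_q /transverse_r /tnth /=.
  rewrite tvecZ tvecD tvecZ; move: s ss => t tt; congr (tvec _ _ _ _ _); try ring.
    by apply: (linear_comb2 (k1 := 2) (k2 := - t * t) tt ii); field.
  by apply: (linear_comb1 (k := t * t) ii); ring.
Qed.

End TransverseFrames.

(** * The characteristic cubic and Cardano's formula *)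

Section Cubic.
Variable C : numClosedFieldType.
Variables P0 P1 P2 P3 P4 : C.
Local Notation I := (invI_of P0 P1 P2 P3 P4).
Local Notation J := (invJ_of P0 P1 P2 P3 P4).

Definition vieta (al : 'I_3 -> C) : Prop :=
  [/\ al 0 + al 1 + al 2 = 0, al 0 * al 1 + al 1 * al 2 + al 2 * al 0 = - I &
      al 0 * al 1 * al 2 = 2 * J].

Lemma vieta_root al x : vieta al -> x ^+ 3 - I * x - 2 * J = 0 ->
  exists i, x = al i.
Proof.
move=> [e1 e2 e3] h.
have : (x - al 0) * (x - al 1) * (x - al 2) = 0.
  rewrite -[RHS]h.
  by apply: (linear_comb3 (k1 := - x ^+ 2) (k2 := x) (k3 := -1) e1 e2 e3); ring.
move/eqP; rewrite !mulf_eq0 !subr_eq0 -orbA => /or3P[] /eqP ->.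
- by exists 0.
- by exists 1.
- by exists 2.
Qed.

Lemma vieta_choice al (x : 'I_3 -> C) : vieta al -> injective x ->
  (forall i, x i ^+ 3 - I * x i - 2 * J = 0) ->
  exists t : {perm 'I_3}, forall i, x i = al (t i).
Proof.
move=> va inj_x hx.
have [f fE] := fin_all_exists (fun i => vieta_root va (hx i)).
have inj_f : injective f by move=> i j e; apply: inj_x; rewrite !fE e.
by exists (perm inj_f) => i; rewrite permE.
Qed.

(** Type I provides distinct roots [x] in no particular order. Each is some al_i, so [x] is a
    permutation of [al], which makes [al] injective. *)
Lemma vieta_spectrum al (x : 'I_3 -> C) : vieta al -> injective x ->
  (forall i, x i ^+ 3 - I * x i - 2 * J = 0) -> spectrum P0 P1 P2 P3 P4 al.
Proof.
move=> va inj_x hx; have [t tE] := vieta_choice va inj_x hx.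
have alE j : al j = x (t^-1%g j) by rewrite tE permKV.
have [e1 e2 e3] := va.
have n1 : ordS 0 = 1 :> 'I_3 by exact/val_inj.
have n2 : ordS 1 = 2 :> 'I_3 by exact/val_inj.
have n3 : ordS 2 = 0 :> 'I_3 by exact/val_inj.
have pairC : al 0 ^+ 2 + al 0 * al 1 + al 1 ^+ 2 = I
  /\ al 1 ^+ 2 + al 1 * al 2 + al 2 ^+ 2 = I
  /\ al 2 ^+ 2 + al 2 * al 0 + al 0 ^+ 2 = I.
  split; [|split].
  - by apply: (linear_comb2 (k1 := al 0 + al 1) (k2 := -1) e1 e2); ring.
  - by apply: (linear_comb2 (k1 := al 1 + al 2) (k2 := -1) e1 e2); ring.
  - by apply: (linear_comb2 (k1 := al 2 + al 0) (k2 := -1) e1 e2); ring.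
have [p01 [p12 p20]] := pairC.
split.
- by move=> i j; rewrite !alE => /inj_x /perm_inj.
- by rewrite (sum_ord3 0) n1 n2.
- have pS i : al i ^+ 2 + al i * al (ordS i) + al (ordS i) ^+ 2 = I.
    by case: (ord3_cases 0 i) => ->; rewrite ?n1 ?n2 ?n3.
  move=> j k; case: (ord3_cases j k) => -> jk; first by rewrite eqxx in jk.
    exact: pS.
  by have := pS (ordS (ordS j)); rewrite ordS3 => <-; ring.
- by move=> j; rewrite alE.
Qed.

Lemma spectrum_comp al (t : {perm 'I_3}) : spectrum P0 P1 P2 P3 P4 al ->
  spectrum P0 P1 P2 P3 P4 (al \o t).
Proof.
move=> [inj_al s0 pI cub]; split.
- by move=> i j /inj_al /perm_inj.
- by rewrite -[RHS]s0 [RHS](reindex_inj (@perm_inj _ t)).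
- by move=> j k jk; apply: pI; rewrite (inj_eq perm_inj).
- by move=> j; apply: cub.
Qed.

(* [w] and [w'] are the primitive cube roots of unity. *)
Lemma cardano (b w w' sq : C) : b != 0 -> w + w' = -1 -> w * w' = 1 ->
  sq ^+ 2 = J ^+ 2 - I ^+ 3 / 27 -> b ^+ 3 = J + sq ->
  let c := I / (3 * b) in
  vieta (fun j => tnth [tuple b + c; w * b + w' * c; w' * b + w * c] j).
Proof.
move=> b0 ww1 ww sq2 b3 /=; set c := I / (3 * b).
have bc : b * c = I / 3 by rewrite /c; field.
(* From b^3 c^3 = I^3 / 27 = J^2 - sq^2 = (J + sq) (J - sq). *)
have c3 : c ^+ 3 = J - sq.
  have nz : b ^+ 3 != 0 by rewrite expf_neq0.
  apply: (mulfI nz); rewrite -exprMn bc b3.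
  by apply: (linear_comb1 (k := 1) sq2); field.
have w'E : w' = -1 - w by apply: (linear_comb1 (k := 1) ww1); ring.
rewrite /vieta /tnth /=; rewrite {}w'E in ww *.
split; first by ring.
- by apply: (linear_comb2 (k1 := - 3) (k2 := b ^+ 2 + c ^+ 2 - 2 * b * c) bc ww); field.
- by apply: (linear_comb3 (k1 := 1) (k2 := 1)
    (k3 := (b + c) * (b ^+ 2 - 2 * b * c + c ^+ 2)) b3 c3 ww); ring.
Qed.

End Cubic.

(** * The spacetime point as an instance *)

Section SpacetimePoint.
Variables (R : realType) (S : spacetime_point R).
Local Notation C := R[i].
Local Notation g := (metric S).

Lemma conj_complexR (x : R) : (real_complex R x)^* = real_complex R x.
Proof.
apply/conj_Creal/complex_realP; by exists x.
Qed.

(** Symmetry is inherited from the diagonal form by congruence. *)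
Lemma gram_sym : (gram S)^T = gram S.
Proof.
have [P Pu eP] := gram_lorentz S.
have -> : gram S = (invmx P)^T *m (P^T *m gram S *m P) *m invmx P.
  by rewrite !mulmxA -trmx_mul mulmxV // trmx1 mul1mx -mulmxA mulmxV // mulmx1.
by rewrite eP !trmx_mul tr_diag_mx trmxK mulmxA.
Qed.

Lemma gram_unit : gram S \in unitmx.
Proof.
have [P Pu eP] := gram_lorentz S.
have : \det (P^T *m gram S *m P) != 0.
  rewrite eP det_diag; apply/prodf_neq0 => i _; rewrite mxE.
  by case: ifP; rewrite ?oppr_eq0 oner_eq0.
by rewrite !det_mulmx !mulf_eq0 !negb_or unitmxE unitfE => /andP[/andP[]].
Qed.

Lemma metric_sym : g^T = g.
Proof. by rewrite /metric -[in RHS]gram_sym; apply/matrixP => i j; rewrite !mxE. Qed.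

Lemma metric_unit : g \in unitmx.
Proof. by rewrite map_unitmx gram_unit. Qed.

Lemma conj_mxE m n (A : 'M[C]_(m, n)) : conj_mx A = map_mx Num.conj A.
Proof. by apply/matrixP => i j; rewrite !mxE. Qed.

Lemma conj_mxM m n p (A : 'M[C]_(m, n)) (B : 'M_(n, p)) :
  conj_mx (A *m B) = conj_mx A *m conj_mx B.
Proof. by rewrite !conj_mxE map_mxM. Qed.

Lemma conj_metric : conj_mx g = g.
Proof. by apply/matrixP => i j; rewrite !mxE conj_complexR. Qed.

Lemma conj_invg : conj_mx (invmx g) = invmx g.
Proof. by rewrite conj_mxE map_invmx -conj_mxE conj_metric. Qed.

Lemma raiseD X Y : raise S (X + Y) = raise S X + raise S Y.
Proof. by rewrite /raise mulmxDr mulmxDl. Qed.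
Lemma raiseZ a X : raise S (a *: X) = a *: raise S X.
Proof. by rewrite /raise -scalemxAr -scalemxAl. Qed.

Lemma hodgeD X Y : hodge S (X + Y) = hodge S X + hodge S Y.
Proof.
apply/matrixP => a b; rewrite !mxE -mulrDr -big_split /=.
apply: (congr1 ( *%R _)).
apply: eq_bigr => c _; rewrite -big_split /=; apply: eq_bigr => d _.
by rewrite raiseD mxE mulrDr.
Qed.
Lemma hodgeZ k X : hodge S (k *: X) = k *: hodge S X.
Proof.
apply/matrixP => a b; rewrite !mxE mulrCA [X in _ = _ * X]mulr_sumr; apply: (congr1 ( *%R _)).
apply: eq_bigr => c _; rewrite mulr_sumr; apply: eq_bigr => d _.
by rewrite raiseZ mxE mulrCA.
Qed.
Lemma conj_eta a b c d : (eta S a b c d)^* = eta S a b c d.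
Proof.
rewrite /eta rmorphM; congr (_ * _); first exact: conj_complexR.
rewrite -det_map_mx; congr (\det _); apply/matrixP => i j.
by rewrite !mxE rmorph_nat.
Qed.

Lemma hodge_conj X : hodge S (conj_mx X) = conj_mx (hodge S X).
Proof.
have -> : hodge S (conj_mx X) = \matrix_(a < 4, b < 4)
    (2^-1 * \sum_(c < 4) \sum_(d < 4) eta S a b c d * (raise S X c d)^*).
  apply/matrixP => a b; rewrite !mxE; congr (2^-1 * _).
  apply: eq_bigr => c _; apply: eq_bigr => d _; congr (_ * _).
  have -> : raise S (conj_mx X) = conj_mx (raise S X).
    by rewrite /raise !conj_mxM conj_invg.
  by rewrite mxE.
apply/matrixP => a b; rewrite !mxE rmorphM fmorphV rmorph_nat; congr (_ * _).
rewrite rmorph_sum; apply: eq_bigr => c _; rewrite rmorph_sum.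
by apply: eq_bigr => d _; rewrite rmorphM; congr (_ * _); rewrite [RHS]conj_eta.
Qed.

End SpacetimePoint.

(** * Traces of operators on 4 x 4 matrices *)

Section Traces.
Variable C : numClosedFieldType.

Lemma tr_lin_mx (f : 'M[C]_4 -> 'M[C]_4) :
  \tr (lin_mx f) = \sum_i \sum_j f (delta_mx i j) i j.
Proof.
rewrite /mxtrace (reindex _ (curry_mxvec_bij _ _)) /= pair_big /=.
apply: eq_bigr => -[i j] _ /=.
by rewrite !mxE /= vec_mx_delta mxvecE.
Qed.

Variables (G : lorentz_data C) (T : lorentz_frame G).
Local Notation F := (tform T).

Lemma sum_pip (A B : 'M[C]_4) :
  \sum_i \sum_j pip G B (delta_mx i j) * A i j = pip G B A.
Proof.
rewrite {2}[A]matrix_sum_delta.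
have pip_sum (I : finType) (f : I -> 'M[C]_4) :
    pip G B (\sum_i f i) = \sum_i pip G B (f i).
  apply: (big_morph _ (pipDr G B)); by rewrite -(scale0r 0) pipZr mul0r.
rewrite pip_sum; apply: eq_bigr => i _; rewrite pip_sum; apply: eq_bigr => j _.
by rewrite pipZr mulrC.
Qed.

(** An operator X -> a(X) U + b(X) W + c(X) V has trace a(U) + b(W) + c(V), also on the
    16-dimensional space of all matrices; only the pairings (U, V) and (W, W) survive. *)
Lemma tr_tform (f : 'M[C]_4 -> 'M[C]_4) (a b c : 'M[C]_4 -> C) a1 a2 a3 b1 b2 b3 c1 c2 c3 :
  (forall X, f X = F (a X) (b X) (c X)) ->
  (forall X, a X = a1 * pu T X + a2 * pw T X + a3 * pv T X) ->
  (forall X, b X = b1 * pu T X + b2 * pw T X + b3 * pv T X) ->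
  (forall X, c X = c1 * pu T X + c2 * pw T X + c3 * pv T X) ->
  \tr (lin_mx f) = 2^-1 * a3 - b2 + 2^-1 * c1.
Proof.
move=> fE aE bE cE; rewrite tr_lin_mx.
have -> : 2^-1 * a3 - b2 + 2^-1 * c1 = pip G (F a1 a2 a3) (F 1 0 0)
   + pip G (F b1 b2 b3) (F 0 1 0) + pip G (F c1 c2 c3) (F 0 0 1).
  by rewrite !tform_ip; field.
rewrite -!sum_pip -!big_split /=; apply: eq_bigr => i _.
rewrite -!big_split /=; apply: eq_bigr => j _.
rewrite fE aE bE cE !pip_tform !tformE.
move: (formU _ _ _) (formW _ _ _ _) (formV _ _ _) => U W V.
by rewrite !mxE; ring.
Qed.

End Traces.

Section Instance.
Variables (R : realType) (S : spacetime_point R).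
Local Notation C := R[i].

Definition point_data : lorentz_data C :=
  @LorentzData C (metric S) (hodge S) (metric_sym S) (metric_unit S) (conj_metric S)
    (@hodgeD R S) (@hodgeZ R S) (@hodge_conj R S).

Lemma frame_of_null (T : tetrad R) : null_frame S T ->
  exists T' : lorentz_frame point_data, [/\ fl T' = lvec T, fk T' = kvec T & fm T' = mvec T].
Proof.
case=> -[[[lR _ _ _] [kR _ _ _]] [ll kk lk] [mm mb] [lm km]] [sW sU sV].
by exists (@LorentzFrame C point_data (lvec T) (kvec T) (mvec T) lR kR
  (And3 ll kk lk) (And4 mm mb lm km) (And3 sW sU sV)).
Qed.

Lemma bivWE T : bivW S T = formW point_data (lvec T) (kvec T) (mvec T).
Proof. by []. Qed.
Lemma bivUE T : bivU S T = formU point_data (lvec T) (mvec T).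
Proof. by []. Qed.
Lemma bivVE T : bivV S T = formV point_data (kvec T) (mvec T).
Proof. by []. Qed.
Lemma dotE x y : dot S x y = pdot point_data x y.
Proof. by []. Qed.

Lemma component_sumE (Psi : 'I_5 -> C) (u w v : C) (U W V : 'M[C]_4) :
  Psi 0 *: (u *: U) + Psi 1 *: (w *: U + u *: W)
  + Psi 2 *: (v *: U + u *: V + w *: W)
  + Psi 3 *: (v *: W + w *: V) + Psi 4 *: (v *: V) = component_sum Psi u w v U W V.
Proof. by []. Qed.

Lemma components_of_weyl Cw T Psi : weyl_components S Cw T Psi <->
  pcomponents point_data (sd_weyl S Cw) (lvec T) (kvec T) (mvec T) Psi.
Proof.
rewrite /weyl_components /stens /tens; cbv zeta.
split=> h X; have := h X; rewrite component_sumE; exact.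
Qed.

Lemma components_frame Cw T Psi (T0 : lorentz_frame point_data) :
  [/\ fl T0 = lvec T, fk T0 = kvec T & fm T0 = mvec T] ->
  weyl_components S Cw T Psi ->
  pcomponents point_data (sd_weyl S Cw) (fl T0) (fk T0) (fm T0) Psi.
Proof. by case=> -> -> -> h; apply/components_of_weyl; exact: h. Qed.

End Instance.

(** The sign of the inner root is free, and J + t and J - t vanish together only if I = J = 0. *)
Lemma cardano_root (C : numClosedFieldType) (I J : C) : I != 0 \/ J != 0 ->
  exists2 b, b != 0 & exists2 sq, sq ^+ 2 = J ^+ 2 - I ^+ 3 / 27 & b ^+ 3 = J + sq.
Proof.
move=> IJ; pose t := sqrtC (J ^+ 2 - I ^+ 3 / 27).
have t2 : t ^+ 2 = J ^+ 2 - I ^+ 3 / 27 by rewrite sqrtCK.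
suff [sq sq2 nz] : exists2 sq, sq ^+ 2 = J ^+ 2 - I ^+ 3 / 27 & J + sq != 0.
  exists (3.-root (J + sq)); first by rewrite rootC_eq0.
  by exists sq; rewrite ?rootCK.
case: (eqVneq (J + t) 0) => [Jt|]; last by exists t.
case: (eqVneq (J - t) 0) => [Jt'|]; last by exists (- t); rewrite ?sqrrN.
have J0 : J = 0.
  by apply: (linear_comb2 (k1 := 2^-1) (k2 := 2^-1) Jt Jt'); field.
have t0 : t = 0 by rewrite J0 add0r in Jt.
have : I ^+ 3 = 0.
  by move: t2; rewrite t0 J0 => t2; apply: (linear_comb1 (k := 27) t2); field.
move/eqP; rewrite expf_eq0 /= => I0.
by case: IJ; rewrite ?I0 ?J0 ?eqxx.
Qed.

Section WeylTraces.
Variables (C : numClosedFieldType) (G : lorentz_data C) (T : lorentz_frame G).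
Variables (L : 'M[C]_4 -> 'M[C]_4) (Psi : 'I_5 -> C).
Hypothesis compT : pcomponents G L (fl T) (fk T) (fm T) Psi.

(** The three triples are the rows of a matrix acting on the pairings with U, W, V rather than on
    coordinates, so [f] is described on all 4 x 4 matrices. *)
Definition coords_op (f : 'M[C]_4 -> 'M[C]_4) (x y z : C * C * C) : Prop :=
  forall X, f X = tform T
    (x.1.1 * pu T X + x.1.2 * pw T X + x.2 * pv T X)
    (y.1.1 * pu T X + y.1.2 * pw T X + y.2 * pv T X)
    (z.1.1 * pu T X + z.1.2 * pw T X + z.2 * pv T X).

Lemma coords_op_weyl : coords_op L
  (2 * Psi 0, 2 * Psi 1, 2 * Psi 2) (2 * Psi 1, 2 * Psi 2, 2 * Psi 3)
  (2 * Psi 2, 2 * Psi 3, 2 * Psi 4).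
Proof. by move=> X; rewrite (weylE compT); congr (tform _ _ _ _) => /=; ring. Qed.

Lemma coords_op_comp f x y z : coords_op f x y z -> coords_op (L \o f)
  (Psi 0 * z.1.1 - 2 * Psi 1 * y.1.1 + Psi 2 * x.1.1,
   Psi 0 * z.1.2 - 2 * Psi 1 * y.1.2 + Psi 2 * x.1.2,
   Psi 0 * z.2 - 2 * Psi 1 * y.2 + Psi 2 * x.2)
  (Psi 1 * z.1.1 - 2 * Psi 2 * y.1.1 + Psi 3 * x.1.1,
   Psi 1 * z.1.2 - 2 * Psi 2 * y.1.2 + Psi 3 * x.1.2,
   Psi 1 * z.2 - 2 * Psi 2 * y.2 + Psi 3 * x.2)
  (Psi 2 * z.1.1 - 2 * Psi 3 * y.1.1 + Psi 4 * x.1.1,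
   Psi 2 * z.1.2 - 2 * Psi 3 * y.1.2 + Psi 4 * x.1.2,
   Psi 2 * z.2 - 2 * Psi 3 * y.2 + Psi 4 * x.2).
Proof.
move=> fE X; rewrite /= fE (weyl_tform compT).
by congr (tform _ _ _ _) => /=; ring.
Qed.

Lemma tr_coords_op f x y z : coords_op f x y z ->
  \tr (lin_mx f) = 2^-1 * x.2 - y.1.2 + 2^-1 * z.1.1.
Proof. by move=> fE; exact: (tr_tform fE). Qed.

Lemma tr_weyl2 :
  2^-1 * \tr (lin_mx (L \o L)) = invI_of (Psi 0) (Psi 1) (Psi 2) (Psi 3) (Psi 4).
Proof.
by rewrite (tr_coords_op (coords_op_comp coords_op_weyl)) /= /invI_of; field.
Qed.

Lemma tr_weyl3 :
  6^-1 * \tr (lin_mx (L \o L \o L)) = invJ_of (Psi 0) (Psi 1) (Psi 2) (Psi 3) (Psi 4).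
Proof.
have h := coords_op_comp (coords_op_comp coords_op_weyl).
by rewrite (tr_coords_op h) /= /invJ_of; field.
Qed.

End WeylTraces.

(** * Time orientation *)

Section Future.
Variable R : realType.

Definition minkowski (x y : 'I_4 -> R) : R :=
  - (x 0 * y 0) + (x 1 * y 1 + x 2 * y 2 + x 3 * y 3).

Lemma cauchy3 (a b c x y z : R) : (a * x + b * y + c * z) ^+ 2 <=
  (a ^+ 2 + b ^+ 2 + c ^+ 2) * (x ^+ 2 + y ^+ 2 + z ^+ 2).
Proof.
rewrite -subr_ge0.
have -> : (a ^+ 2 + b ^+ 2 + c ^+ 2) * (x ^+ 2 + y ^+ 2 + z ^+ 2) -
    (a * x + b * y + c * z) ^+ 2 =
    (a * y - b * x) ^+ 2 + (a * z - c * x) ^+ 2 + (b * z - c * y) ^+ 2 by ring.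
by rewrite !addr_ge0 ?sqr_ge0.
Qed.

(** If x_0 y_0 <= 0, the spatial product p satisfies p < x_0 y_0 <= 0, so p^2 exceeds (x_0 y_0)^2,
    against Cauchy-Schwarz for causal vectors. *)
Lemma minkowski_sign x y : minkowski x x <= 0 -> minkowski y y <= 0 ->
  minkowski x y < 0 -> 0 < x 0 * y 0.
Proof.
rewrite /minkowski => xx yy xy.
have := cauchy3 (x 1) (x 2) (x 3) (y 1) (y 2) (y 3).
set p := _ + _ + _ in xy *; set X := _ + _ + _; set Y := _ + _ + _ => cs.
have X0 : 0 <= X by rewrite !addr_ge0 ?sqr_ge0.
have Xx : X <= x 0 ^+ 2 by rewrite /X; lra.
have Yy : Y <= y 0 ^+ 2 by rewrite /Y; lra.
have XY : X * Y <= (x 0 * y 0) ^+ 2.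
  by rewrite exprMn; apply: le_trans (ler_wpM2l X0 Yy) (ler_wpM2r (sqr_ge0 _) Xx).
rewrite ltNge; apply/negP => h.
have : (x 0 * y 0) ^+ 2 < p ^+ 2 by rewrite -subr_gt0 subr_sqr; nra.
by rewrite ltNge (le_trans cs XY).
Qed.

Lemma minkowski_future x y : minkowski x x <= 0 -> minkowski y y < 0 ->
  0 < x 0 * y 0 -> minkowski x y < 0.
Proof.
rewrite /minkowski => xx yy xy.
have := cauchy3 (x 1) (x 2) (x 3) (y 1) (y 2) (y 3).
set p := _ + _ + _; set X := _ + _ + _; set Y := _ + _ + _ => cs.
have X0 : 0 <= X by rewrite !addr_ge0 ?sqr_ge0.
have Y0 : 0 <= Y by rewrite !addr_ge0 ?sqr_ge0.
have Xx : X <= x 0 ^+ 2 by rewrite /X; lra.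
have Yy : Y < y 0 ^+ 2 by rewrite /Y; lra.
have x0 : 0 < x 0 ^+ 2.
  rewrite lt_neqAle sqr_ge0 andbT eq_sym sqrf_eq0.
  by apply: contraTneq xy => ->; rewrite mul0r ltxx.
have XY : X * Y < (x 0 * y 0) ^+ 2.
  rewrite exprMn; apply: le_lt_trans (ler_wpM2r Y0 Xx) _.
  by rewrite ltr_pM2l.
rewrite addrC subr_lt0 ltNge; apply/negP => h.
have : (x 0 * y 0) ^+ 2 <= p ^+ 2 by rewrite -subr_ge0 subr_sqr; nra.
by rewrite leNgt (le_lt_trans cs XY).
Qed.

(** Only agreement of time components counts: x agrees with t and with y, so y agrees with t. The
    Lorentz basis may therefore be past-directed. *)
Lemma minkowski_trans x y t : minkowski x x <= 0 -> minkowski y y <= 0 ->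
  minkowski t t < 0 -> minkowski x t < 0 -> minkowski x y < 0 -> minkowski y t < 0.
Proof.
move=> xx yy tt xt xy; apply: minkowski_future => //.
have h1 := minkowski_sign xx (ltW tt) xt; have h2 := minkowski_sign xx yy xy.
have x0 : x 0 != 0 by apply: contraTneq h1 => ->; rewrite mul0r ltxx.
have : 0 < x 0 ^+ 2 * (y 0 * t 0).
  have -> : x 0 ^+ 2 * (y 0 * t 0) = (x 0 * y 0) * (x 0 * t 0) by ring.
  exact: mulr_gt0.
by rewrite pmulr_rgt0 // lt_neqAle sqr_ge0 andbT eq_sym sqrf_eq0.
Qed.

Variable S : spacetime_point R.

Lemma real_vecP (v : 'cV[R[i]]_4) : is_real_vec v ->
  exists x : 'cV[R]_4, v = map_mx (real_complex R) x.
Proof.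
move=> vR; have h i : exists y : R, v i 0 = real_complex R y.
  have /complex_realP[y ->] : v i 0 \is Num.real; last by exists y.
  by apply/CrealP; rewrite -{2}vR mxE.
have [y yE] := fin_all_exists h.
by exists (\col_i y i); apply/colP => i; rewrite !mxE yE.
Qed.

Lemma dot_minkowski : exists f : 'cV[R]_4 -> 'I_4 -> R, forall x y,
  dot S (map_mx (real_complex R) x) (map_mx (real_complex R) y) =
  real_complex R (minkowski (f x) (f y)).
Proof.
have [P Pu PE] := gram_lorentz S.
exists (fun x i => (invmx P *m x) i 0) => x y.
have -> : dot S (map_mx (real_complex R) x) (map_mx (real_complex R) y) =
    real_complex R ((x^T *m gram S *m y) 0 0).
  rewrite /dot /metric; have -> : (map_mx (real_complex R) x)^T = map_mx (real_complex R) x^T.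
    by apply/matrixP => i j; rewrite !mxE.
  by rewrite -!map_mxM mxE.
congr (real_complex R _).
rewrite -{1}(mulKVmx Pu x) -{1}(mulKVmx Pu y).
move: (invmx P *m x) (invmx P *m y) => u v.
have -> : (P *m u)^T *m gram S *m (P *m v) = u^T *m (P^T *m gram S *m P) *m v.
  by rewrite trmx_mul !mulmxA.
rewrite PE -mulmxA mul_diag_mx mxE !big_ord_recl big_ord0 !mxE /= /minkowski.
have e1 : lift ord0 ord0 = 1 :> 'I_4 by apply/val_inj.
have e2 : lift ord0 (lift ord0 ord0) = 2 :> 'I_4 by apply/val_inj.
have e3 : lift ord0 (lift ord0 (lift ord0 ord0)) = 3 :> 'I_4 by apply/val_inj.
by rewrite e1 e2 e3; ring.
Qed.

Lemma real_complex_lt0 (x : R) : (real_complex R x < 0) = (x < 0).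
Proof. by rewrite -(rmorph0 (real_complex R)) ltcR. Qed.

Lemma real_complex_le0 (x : R) : (real_complex R x <= 0) = (x <= 0).
Proof. by rewrite -(rmorph0 (real_complex R)) lecR. Qed.

Lemma future_trans u v : future_pointing S u -> is_real_vec v ->
  dot S v v <= 0 -> dot S u v < 0 -> future_pointing S v.
Proof.
case=> uR u0 uu ut vR vv uv.
have v0 : v != 0.
  by apply: contraTneq uv => ->; rewrite /dot mulmx0 mxE ltxx.
have [x xE] := real_vecP uR; have [y yE] := real_vecP vR.
have [f fE] := dot_minkowski.
have tt : dot S (map_mx (real_complex R) (tdir S)) (map_mx (real_complex R) (tdir S)) < 0.
  have -> : dot S (map_mx (real_complex R) (tdir S)) (map_mx (real_complex R) (tdir S))
      = real_complex R (((tdir S)^T *m gram S *m tdir S) 0 0).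
    rewrite /dot /metric; have -> : (map_mx (real_complex R) (tdir S))^T
      = map_mx (real_complex R) (tdir S)^T by apply/matrixP => i j; rewrite !mxE.
    by rewrite -!map_mxM mxE.
  by rewrite real_complex_lt0 tdir_timelike.
split; [exact: vR | exact: v0 | exact: vv | ].
move: uu ut vv uv tt; rewrite xE yE !fE !real_complex_lt0 !real_complex_le0.
by move=> uu ut vv uv tt; apply: (minkowski_trans uu vv tt ut uv).
Qed.

End Future.

(** * The canonical frame and its tetrads at a spacetime point *)

Section Canonical.
Variables (R : realType) (S : spacetime_point R).
Variable Cw : 'I_4 -> 'I_4 -> 'I_4 -> 'I_4 -> R.
Local Notation C := R[i].
Local Notation G := (point_data S).
Local Notation L := (sd_weyl S Cw).
Variables (al : 'I_3 -> C) (W : 'I_3 -> 'M[C]_4).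
Variables (e0 : 'cV[C]_4) (e : 'I_3 -> 'cV[C]_4).
Hypothesis pW : pauli_triple G W.
Hypothesis e0R : cjmx e0 = e0.
Hypothesis e01 : pdot G e0 e0 = -1.
Hypothesis eR : forall i, cjmx (e i) = e i.
Hypothesis eE : forall i, e i = sqrtC 2 *: papp G (W i) e0.
Hypothesis fut : future_pointing S e0.

Lemma lvec_tetrad_of i : lvec (tetrad_of e0 e i) = pauli_l e0 e i.
Proof. by []. Qed.
Lemma kvec_tetrad_of i : kvec (tetrad_of e0 e i) = pauli_k e0 e i.
Proof. by []. Qed.
Lemma mvec_tetrad_of i : mvec (tetrad_of e0 e i) = pauli_m e i.
Proof. by []. Qed.

Lemma canonical_weyl_frame : weyl_canonical_frame S W e0 e.
Proof.
split.
- by split; [exact: fut | exact: eR].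
- split; [exact: e01 | | ] => i.
    exact: (pauli_dot0 pW eE).
  by move=> j; exact: (pauli_dot pW eE e01).
- move=> i; split; first exact: e0R.
  apply: (@papp_eq0 _ G); rewrite pappDl pappNl.
  by rewrite (pauli_app0 eE) (pauli_conj_app0 eE e0R eR) subrr.
- move=> i j; case: ifPn => [/eqP <-|ij].
    split; first exact: eR.
    apply: (@papp_eq0 _ G); rewrite pappDl pappNl.
    by rewrite (pauli_app_diag pW eE) (pauli_conj_app_diag pW eE e0R eR) subrr.
  split; first exact: eR.
  apply: (@papp_eq0 _ G); rewrite pappDl.
  case: (ord3_cases i j) ij => -> ij; first by rewrite eqxx in ij.
    rewrite (pauli_app_succ pW eE) (pauli_conj_app_succ pW eE eR).
    by rewrite mulNr scaleNr addNr.
  rewrite (pauli_app_pred pW eE) (pauli_conj_app_pred pW eE eR).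
  by rewrite mulNr scaleNr addrN.
- move=> i; exact: (pauli_canonical pW eE e0R e01 eR).
Qed.

Lemma canonical_transverse i :
  (forall X, L X = - \sum_i (al i * pip G (W i) X) *: W i) -> \sum_i al i = 0 ->
  principal_transverse_frame S Cw (tetrad_of e0 e i) /\
  frame_corresponds S (tetrad_of e0 e i) (W i).
Proof.
move=> LE s0.
have lE := lvec_tetrad_of i; have kE := kvec_tetrad_of i; have mE := mvec_tetrad_of i.
have WE := pauli_formW pW eE e0R e01 eR i.
have [sW sU sV] := pauli_frame_self_dual pW eE e0R e01 eR i.
have [[ll kk lk] mm mmb lm km] := pauli_frame_dots pW eE e01 eR i.
have [lR kR] := pauli_lk_real e0R eR i.
have [lF kF] := pauli_lk_future pW eE e01 i.
split; last by right; rewrite bivWE lE kE mE.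
split.
  split; last first.
    by rewrite bivWE bivUE bivVE lE kE mE; split; [exact: sW | exact: sU | exact: sV].
  rewrite /null_tetrad lE kE mE.
  split; [split | by split; [exact: ll | exact: kk | exact: lk]
    | by split; [exact: mm | exact: mmb] | by split; [exact: lm | exact: km]].
  - by apply: (future_trans fut lR); [rewrite dotE ll; exact: lexx | exact: lF].
  - by apply: (future_trans fut kR); [rewrite dotE kk; exact: lexx | exact: kF].
have comp := pauli_components i pW eE e0R e01 eR LE s0.
exists (transverse_psi (2^-1 * (al (ordS (ordS i)) - al (ordS i))) (- 2^-1 * al i)).
  by apply/components_of_weyl; rewrite lE kE mE; exact: comp.
by [].
Qed.

End Canonical.

Section FrameAssembly.
Variables (R : realType) (S : spacetime_point R).
Variable Cw : 'I_4 -> 'I_4 -> 'I_4 -> 'I_4 -> R.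
Variables (T : tetrad R) (Psi : 'I_5 -> R[i]).
Local Notation C := R[i].
Local Notation G := (point_data S).
Local Notation L := (sd_weyl S Cw).
Variable T0 : lorentz_frame G.
Hypothesis T0E : [/\ fl T0 = lvec T, fk T0 = kvec T & fm T0 = mvec T].
Hypothesis frameT : null_frame S T.
Hypothesis compT : pcomponents G L (fl T0) (fk T0) (fm T0) Psi.
Local Notation spectral := (spectrum (Psi 0) (Psi 1) (Psi 2) (Psi 3) (Psi 4) : ('I_3 -> C) -> Prop).

Lemma form_combE (r a b c : C) :
  r^-1 *: (a *: bivU S T + b *: bivW S T + c *: bivV S T) = r^-1 *: tform T0 a b c.
Proof.
have [e1 e2 e3] := T0E.
by rewrite tformE e1 e2 e3 bivWE bivUE bivVE.
Qed.

Lemma principal_formulaP al W : principal_formula S T Psi al W <-> pformula T0 Psi al W.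
Proof.
split=> h i Ci; have [d dE WE] := h i Ci.
  by exists d; [exact: dE | rewrite WE form_combE].
by exists d; [exact: dE | rewrite WE -form_combE].
Qed.

Lemma canonical_e0E al p q r : spectral al -> principal_coords Psi al p q r ->
  canonical_e0 T Psi al = (2 * sqrtC (rr r))^-1 *:
    tvec T0 (2 + qr q r * (qr q r)^* / rr r) (rr r) (qr q r) (qr q r)^*.
Proof.
move=> sp pc; have [e1 e2 e3] := T0E.
have bE : coefb Psi al = rr r := coefb_rr sp pc.
have cE : coefc Psi al = qr q r := coefc_qr sp pc.
by rewrite /canonical_e0 /coefa bE cE tvecE e1 e2 e3.
Qed.

Lemma poriented_of W : oriented_triple S W <-> poriented G W.
Proof. by []. Qed.

Lemma principal_results al W : spectral al ->
  principal_formula S T Psi al W -> oriented_triple S W ->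
  let e0 := canonical_e0 T Psi al in
  let e := canonical_ei S W e0 in
  [/\ pauli_triple G W, conj_mx e0 = e0, pdot G e0 e0 = -1,
      forall i, conj_mx (e i) = e i & future_pointing S e0] /\
  [/\ forall i j, pip G (W i) (W j) = - (i == j)%:R,
      forall i, L (W i) = al i *: W i &
      forall X, L X = - \sum_i (al i * pip G (W i) X) *: W i].
Proof.
move=> sp fW oW e0 e.
have /principal_formulaP fW' := fW.
have [p [q [r [pc WE]]]] := formula_coords sp fW' oW.
have [h o eig] := pc.
have e0E : e0 = _ := canonical_e0E sp pc.
have eE i : e i = sqrtC 2 *: papp G (tform T0 (p i) (q i) (r i)) e0.
  by rewrite -WE.
have e0R : conj_mx e0 = e0 by rewrite e0E; exact: canonical_real.
have e01 : pdot G e0 e0 = -1 by rewrite e0E; exact: canonical_unit h.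
split; split.
- exact: pauli_ext WE (coords_pauli T0 h o).
- exact: e0R.
- exact: e01.
- move=> i; rewrite eE e0E; exact: canonical_ei_real h o i.
- have [[[fut _] _ _ _] _] := frameT.
  apply: (future_trans fut e0R).
    by rewrite dotE e01 oppr_le0 ler01.
  (* The product of l with e_0 is - sqrt(b) / 2, so e_0 lies in the same half of the cone as l. *)
  have -> : lvec T = fl T0 by case: T0E.
  rewrite dotE e0E tvec_l pdotZr tvec_dot.
  have b0 : 0 < rr r by rewrite lt_neqAle rr_ge0 eq_sym (rr_neq0 h).
  have -> : - (1 * rr r + 0 * (2 + qr q r * (qr q r)^* / rr r)) +
     (0 * (qr q r)^* + 0 * qr q r) = - rr r by ring.
  rewrite mulrN oppr_lt0 mulr_gt0 // invr_gt0 mulr_gt0 ?ltr0n //.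
  by rewrite sqrtC_gt0.
- by move=> i j; rewrite !WE tform_ip h.
- by move=> i; rewrite !WE; apply/(weyl_eigen compT).
- move=> X; rewrite (weyl_spectral compT X pc); congr (- _).
  by apply: eq_bigr => i _; rewrite WE.
Qed.

Lemma principal_forms_exist al : spectral al ->
  exists2 W, principal_formula S T Psi al W & oriented_triple S W.
Proof.
move=> sp; have [p [q [r pc]]] := principal_exists sp.
have [h o _] := pc.
exists (fun i => tform T0 (p i) (q i) (r i)).
  by apply/principal_formulaP; apply: coords_formula.
apply/poriented_of.
have := pauli_oriented 0 (coords_pauli T0 h o).
have -> : ordS 0 = 1 :> 'I_3 by exact/val_inj.
by have -> : ordS 1 = 2 :> 'I_3 by exact/val_inj.
Qed.

(** The sums b and c run over all eigenvalues. The converse needs this, since a given frame matches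
    [al] only up to order. *)
Lemma canonical_e0_perm al (t : {perm 'I_3}) :
  canonical_e0 T Psi (al \o t) = canonical_e0 T Psi al.
Proof.
have bE : coefb Psi (al \o t) = coefb Psi al.
  by rewrite /coefb [RHS](reindex_inj (@perm_inj _ t)).
have cE : coefc Psi (al \o t) = coefc Psi al.
  by rewrite /coefc [in RHS](reindex_inj (@perm_inj _ t)).
by rewrite /canonical_e0 /coefa bE cE.
Qed.

End FrameAssembly.

Lemma det_invJ (C : numClosedFieldType) (Psi : 'I_5 -> C) :
  \det (\matrix_(i < 3, j < 3) Psi (inord (4 - (i + j)))) =
  invJ_of (Psi 0) (Psi 1) (Psi 2) (Psi 3) (Psi 4).
Proof.
have i0 : inord 0 = 0 :> 'I_5 by apply/val_inj; rewrite /= inordK.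
have i1 : inord 1 = 1 :> 'I_5 by apply/val_inj; rewrite /= inordK.
have i2 : inord 2 = 2 :> 'I_5 by apply/val_inj; rewrite /= inordK.
have i3 : inord 3 = 3 :> 'I_5 by apply/val_inj; rewrite /= inordK.
have i4 : inord 4 = 4 :> 'I_5 by apply/val_inj; rewrite /= inordK.
rewrite (expand_det_row _ 0) !big_ord_recl big_ord0 /cofactor.
rewrite !(expand_det_row _ 0) !big_ord_recl !big_ord0 /cofactor !det_mx11 !mxE /=.
rewrite ?i0 ?i1 ?i2 ?i3 ?i4.
by rewrite /invJ_of /bump /=; ring.
Qed.

Section Eigenvalues.
Variable R : realType.
Local Notation C := R[i].
Variable Psi : 'I_5 -> C.

Lemma psiIE : psiI Psi = invI_of (Psi 0) (Psi 1) (Psi 2) (Psi 3) (Psi 4).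
Proof. by []. Qed.

Lemma psiJE : psiJ Psi = invJ_of (Psi 0) (Psi 1) (Psi 2) (Psi 3) (Psi 4).
Proof. exact: det_invJ. Qed.

Lemma alpha_vieta beta : is_beta Psi beta ->
  vieta (Psi 0) (Psi 1) (Psi 2) (Psi 3) (Psi 4) (alpha Psi beta : 'I_3 -> C).
Proof.
rewrite /is_beta psiIE psiJE => -[b0 [sq sq2 b3]].
have t3 : sqrtC 3 * sqrtC 3 = 3 :> C by rewrite -expr2 sqrtCK.
have ii : 'i * 'i = -1 :> C by rewrite -expr2 sqrCi.
pose w : C := - 2^-1 * (1 - 'i * sqrtC 3); pose w' : C := - 2^-1 * (1 + 'i * sqrtC 3).
have ww1 : w + w' = -1 by rewrite /w /w'; field.
have ww : w * w' = 1.
  rewrite /w /w'; move: (sqrtC 3) t3 => u uu.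
  by apply: (linear_comb2 (k1 := 4^-1) (k2 := - 4^-1 * u * u) uu ii); field.
have [v1 v2 v3] := cardano b0 ww1 ww sq2 b3.
have a0 : alpha Psi beta 0 = beta + psiI Psi / (3 * beta) by [].
have a1 : alpha Psi beta 1 = w * beta + w' * (psiI Psi / (3 * beta)).
  rewrite /alpha /tnth /= /w /w'; move: (psiI Psi / _) => c; ring.
have a2 : alpha Psi beta 2 = w' * beta + w * (psiI Psi / (3 * beta)).
  rewrite /alpha /tnth /= /w /w'; move: (psiI Psi / _) => c; ring.
by rewrite /vieta a0 a1 a2; split; [exact: v1 | exact: v2 | exact: v3].
Qed.

End Eigenvalues.

(** * Existence of the root, and the converse for arbitrary principal transverse frames *)

Section Transverse.
Variables (R : realType) (S : spacetime_point R).
Variable Cw : 'I_4 -> 'I_4 -> 'I_4 -> 'I_4 -> R.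
Variables (T : tetrad R) (Psi : 'I_5 -> R[i]).
Hypothesis frameT : null_frame S T.
Hypothesis compT : weyl_components S Cw T Psi.
Local Notation C := R[i].
Local Notation G := (point_data S).

Lemma invariants : invI S Cw = psiI Psi /\ invJ S Cw = psiJ Psi.
Proof.
have [T0 T0E] := frame_of_null frameT.
have comp := components_frame T0E compT.
rewrite psiIE psiJE; split; first exact: (tr_weyl2 comp).
exact: (tr_weyl3 comp).
Qed.

Hypothesis typeI : type_I S Cw.

Lemma type_I_roots : exists2 x : 'I_3 -> C, injective x &
  forall i, x i ^+ 3 - invI_of (Psi 0) (Psi 1) (Psi 2) (Psi 3) (Psi 4) * x i
    - 2 * invJ_of (Psi 0) (Psi 1) (Psi 2) (Psi 3) (Psi 4) = 0.
Proof.
have [x [inj_x hx]] := typeI; exists x => // i.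
by have := hx i; rewrite /char_eq (proj1 invariants) (proj2 invariants) psiIE psiJE.
Qed.

(** I = J = 0 would reduce the cubic to x^3, which has no distinct roots. *)
Lemma beta_exists : exists beta, is_beta Psi beta.
Proof.
have [x inj_x hx] := type_I_roots.
have [|b b0 [sq sq2 b3]] := @cardano_root C (psiI Psi) (psiJ Psi).
  apply/orP; rewrite -negb_and; apply/negP => /andP[/eqP I0 /eqP J0].
  rewrite psiIE in I0; rewrite psiJE in J0.
  have x0 i : x i = 0.
    have := hx i; rewrite I0 J0 mul0r mulr0 !subr0 => /eqP.
    by rewrite expf_eq0 /= => /eqP.
  by have /eqP := inj_x 0 1 (etrans (x0 0) (esym (x0 1))).
by exists b; split=> //; exists sq.
Qed.

Variable al : 'I_3 -> C.
Hypothesis al_vieta : vieta (Psi 0) (Psi 1) (Psi 2) (Psi 3) (Psi 4) al.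

Lemma al_spectrum : spectrum (Psi 0) (Psi 1) (Psi 2) (Psi 3) (Psi 4) al.
Proof. by have [x inj_x hx] := type_I_roots; apply: vieta_spectrum hx. Qed.

(** The eigenvalues read off from [T'] are all the roots of the cubic, hence [al] in some order [t].
    The index is always 0: which of the W_i the frame belongs to is absorbed in [t]. *)
Lemma transverse_frames T' : principal_transverse_frame S Cw T' ->
  exists (t : {perm 'I_3}) (W : 'I_3 -> 'M[C]_4) (i : 'I_3),
    [/\ principal_formula S T Psi (al \o t) W, oriented_triple S W &
        T' = tetrad_of (canonical_e0 T Psi al)
          (canonical_ei S W (canonical_e0 T Psi al)) i].
Proof.
move=> [frameT' [Psi' compT' transv]].
have [T0 T0E] := frame_of_null frameT.
have comp := components_frame T0E compT.
have [T1 T1E] := frame_of_null frameT'; have [d1 d2 d3] := T1E.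
have comp' := components_frame T1E compT'.
have eI : invI_of (Psi 0) (Psi 1) (Psi 2) (Psi 3) (Psi 4)
    = invI_of (Psi' 0) (Psi' 1) (Psi' 2) (Psi' 3) (Psi' 4).
  by rewrite -(tr_weyl2 comp) -(tr_weyl2 comp').
have eJ : invJ_of (Psi 0) (Psi 1) (Psi 2) (Psi 3) (Psi 4)
    = invJ_of (Psi' 0) (Psi' 1) (Psi' 2) (Psi' 3) (Psi' 4).
  by rewrite -(tr_weyl3 comp) -(tr_weyl3 comp').
have va : vieta (Psi 0) (Psi 1) (Psi 2) (Psi 3) (Psi 4) (transverse_al Psi').
  rewrite /vieta eI eJ; exact: transverse_vieta.
have [x inj_x hx] := type_I_roots.
have sp := vieta_spectrum va inj_x hx.
have [inj_tal _ _ cub] := sp.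
have [t tE] := vieta_choice al_vieta inj_tal cub.
have [p [q [r [[h o eig] FE]]]] := transverse_coords comp comp' transv inj_tal.
have pc : principal_coords Psi (al \o t) p q r.
  by split=> // j; rewrite /= -tE.
have sp' := spectrum_comp t al_spectrum.
pose W j := tform T1 (transverse_p C j) (transverse_q C j) (transverse_r C j).
have fW : principal_formula S T Psi (al \o t) W.
  apply: (proj2 (principal_formulaP Psi T0E _ _)) => i Ci.
  have [d dE WE] := coords_formula T0 sp' pc Ci.
  by exists d; [exact: dE | exact: (etrans (esym (FE i)) WE)].
have pW : pauli_triple G W.
  by have [h' o' _] := transverse_principal transv; apply: coords_pauli.
have oW : oriented_triple S W.
  have := pauli_oriented 0 pW.
  have -> : ordS 0 = 1 :> 'I_3 by exact/val_inj.
  by have -> : ordS 1 = 2 :> 'I_3 by exact/val_inj.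
exists t, W, 0; split=> //.
have [[_ e0R e01 eR fut] _] := principal_results T0E frameT comp sp' fW oW.
rewrite canonical_e0_perm in e0R e01 eR fut.
move: e0R e01 eR fut; move: (canonical_e0 T Psi al) => e0 e0R e01 eR fut.
have eWR j : cjmx (sqrtC 2 *: papp G (W j) e0) = sqrtC 2 *: papp G (W j) e0.
  exact: eR.
have [[lE kE mE]|e0E] := transverse_canonical e0R e01 eWR.
  rewrite d1 in lE; rewrite d2 in kE; rewrite d3 in mE.
  case: T' lE kE mE {frameT' compT' T1E d1 d2 d3} => l k m /= <- <- <-.
  by [].
(* The other sign would make e_0 past-pointing, as l and k of [T'] are future-pointing. *)
have [_ _ _ fe] := fut.
have [[[_ _ _ fl'] [_ _ _ fk']] _ _ _] := proj1 frameT'.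
exfalso; move: fe; rewrite dotE e0E pdotNl pdotZl pdotDl d1 d2 oppr_lt0.
rewrite pmulr_rgt0; last by rewrite invr_gt0 sqrtC_gt0 ltr0n.
rewrite dotE in fl'; rewrite dotE in fk'.
by move=> pos; have := lt_trans pos (ltr_wnDr (ltW fk') fl'); rewrite ltxx.
Qed.

End Transverse.

Theorem corollary2 (R : realType) (S : spacetime_point R)
    (Cw : 'I_4 -> 'I_4 -> 'I_4 -> 'I_4 -> R)
    (weylC : is_weyl_tensor S Cw) (typeI : type_I S Cw)
    (T : tetrad R) (frameT : null_frame S T)
    (Psi : 'I_5 -> R[i]) (compT : weyl_components S Cw T Psi) :
  [/\ invI S Cw = psiI Psi, invJ S Cw = psiJ Psi,
      exists beta : R[i], is_beta Psi beta &
      forall beta : R[i], is_beta Psi beta ->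
        let al := alpha Psi beta in
        let e0 := canonical_e0 T Psi al in
        [/\ exists2 W : 'I_3 -> 'M[R[i]]_4,
              principal_formula S T Psi al W & oriented_triple S W,
            forall W : 'I_3 -> 'M[R[i]]_4,
              principal_formula S T Psi al W -> oriented_triple S W ->
              let e := canonical_ei S W e0 in
              [/\ principal_forms S Cw al W,
                  weyl_canonical_frame S W e0 e &
                  forall i : 'I_3,
                    principal_transverse_frame S Cw (tetrad_of e0 e i) /\
                    frame_corresponds S (tetrad_of e0 e i) (W i)] &
            forall T' : tetrad R, principal_transverse_frame S Cw T' ->
              exists (s : {perm 'I_3}) (W : 'I_3 -> 'M[R[i]]_4) (i : 'I_3),
                [/\ principal_formula S T Psi (al \o s) W,
                    oriented_triple S W &
                    T' = tetrad_of e0 (canonical_ei S W e0) i]]].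
Proof.
have [eI eJ] := invariants frameT compT.
have [T0 T0E] := frame_of_null frameT.
have comp := components_frame T0E compT.
split; [exact: eI | exact: eJ | exact: (beta_exists frameT compT typeI) | ].
move=> beta /alpha_vieta va al e0.
have sp := al_spectrum frameT compT typeI va; have [_ s0 _ _] := sp.
split; first exact: (principal_forms_exist T0E sp).
  move=> W fW oW e.
  have [[pW e0R e01 eR fut] [ip LW LE]] := principal_results T0E frameT comp sp fW oW.
  have eE j : e j = sqrtC 2 *: papp (point_data S) (W j) e0 by [].
  split.
  - by split; [exact: (pauli_sd pW) | exact: ip | exact: LW].
  - exact: (canonical_weyl_frame pW e0R e01 eR eE fut).
  - by move=> i; exact: (canonical_transverse pW e0R e01 eR eE fut i LE s0).
exact: (transverse_frames frameT compT typeI va).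
Qed.
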